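(* Let $\{f_n\}$ be a sequence of Laplace integrable functions on $[a,b]$ such that (A) there is a function $g$ Laplace integrable on $[a,b]$ with $f_n\geqslant g$ almost everywhere on $[a,b]$ for all $n\in\mathbb{N}$, and (B) $\lim_{n\to\infty}f_n=f$ almost everywhere on $[a,b]$ for a function $f\colon[a,b]\to\mathbb{R}$. Then [$f$ is Laplace integrable on $[a,b]$ and $\lim_{n\to\infty}\int_a^xf_n=\int_a^xf$ for all $x\in[a,b]$] if and only if the sequence of functions $x\mapsto\int_a^x(f_n-g)$ is equiabsolutely continuous on $[a,b]$.
   Context: Laplace integral on $[a,b]$: with lower/upper Laplace derivates $\underline{LD}_1F(x)$, $\overline{LD}_1F(x)$ being the minimum of the $\liminf$'s, resp. maximum of the $\limsup$'s, as $s\to\infty$ of $s^2\int_0^\delta e^{-st}[F(x+t)-F(x)]dt$ and $(-s^2)\int_0^\delta e^{-st}[F(x-t)-F(x)]dt$ (one-sided at endpoints), a major function of $f$ is a continuous $U$ with $\underline{LD}_1U\geqslant f$, $\underline{LD}_1U>-\infty$ everywhere on $[a,b]$, a minor function a continuous $V$ with $\overline{LD}_1V\leqslant f$, $\overline{LD}_1V<\infty$ everywhere, and $f$ is Laplace integrable if $\sup_V(V(b)-V(a))=\inf_U(U(b)-U(a))$ is finite, this value being $\int_a^bf$. A sequence $\{F_n\}$ of functions on $[a,b]$ is equiabsolutely continuous on $[a,b]$ if for every $\epsilon>0$ there is $\eta>0$ such that for every finite family of non-overlapping intervals $[x_i,y_i]\subseteq[a,b]$ with $\sum_i(y_i-x_i)<\eta$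 one has $\sum_i|F_n(y_i)-F_n(x_i)|<\epsilon$ for all $n$. *)

(* Defs.v *)
From Stdlib Require Import Reals Lra.
From Coquelicot Require Import Coquelicot.
Open Scope R_scope.

Definition liminf_pinfty (phi : R -> R) : Rbar :=
  Rbar_lub (fun y => exists M : R,
    y = Rbar_glb (fun z => exists s, M <= s /\ z = Finite (phi s))).
Definition limsup_pinfty (phi : R -> R) : Rbar :=
  Rbar_glb (fun y => exists M : R,
    y = Rbar_lub (fun z => exists s, M <= s /\ z = Finite (phi s))).

Definition LT_right (F : R -> R) (b x s : R) : R :=
  s ^ 2 * RInt (fun t => exp (- (s * t)) * (F (x + t) - F x)) 0 (b - x).
Definition LT_left (F : R -> R) (a x s : R) : R :=
  - (s ^ 2) * RInt (fun t => exp (- (s * t)) * (F (x - t) - F x)) 0 (x - a).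

Definition lowerLD (F : R -> R) (a b x : R) : Rbar :=
  match Rlt_dec x b, Rlt_dec a x with
  | left _, left _ => Rbar_min (liminf_pinfty (LT_right F b x))
                               (liminf_pinfty (LT_left F a x))
  | left _, right _ => liminf_pinfty (LT_right F b x)
  | right _, left _ => liminf_pinfty (LT_left F a x)
  | right _, right _ => p_infty
  end.

Definition upperLD (F : R -> R) (a b x : R) : Rbar :=
  match Rlt_dec x b, Rlt_dec a x with
  | left _, left _ => Rbar_opp (Rbar_min (Rbar_opp (limsup_pinfty (LT_right F b x)))
                         (Rbar_opp (limsup_pinfty (LT_left F a x))))
  | left _, right _ => limsup_pinfty (LT_right F b x)
  | right _, left _ => limsup_pinfty (LT_left F a x)
  | right _, right _ => m_infty
  end.

Definition cont_on (F : R -> R) (a b : R) : Prop :=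
  forall x, a <= x <= b ->
    filterlim F (within (fun y => a <= y <= b) (locally x)) (locally (F x)).

Definition major (f U : R -> R) (a b : R) : Prop :=
  cont_on U a b /\
  forall x, a <= x <= b ->
    Rbar_le (Finite (f x)) (lowerLD U a b x) /\ lowerLD U a b x <> m_infty.

Definition minor (f V : R -> R) (a b : R) : Prop :=
  cont_on V a b /\
  forall x, a <= x <= b ->
    Rbar_le (upperLD V a b x) (Finite (f x)) /\ upperLD V a b x <> p_infty.

Definition minor_sup (f : R -> R) (a b : R) : Rbar :=
  Rbar_lub (fun y => exists V, minor f V a b /\ y = Finite (V b - V a)).
Definition major_inf (f : R -> R) (a b : R) : Rbar :=
  Rbar_glb (fun y => exists U, major f U a b /\ y = Finite (U b - U a)).

Definition LaplaceIntegrable (f : R -> R) (a b : R) : Prop :=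
  exists I : R, minor_sup f a b = Finite I /\ major_inf f a b = Finite I.

Definition LInt (f : R -> R) (a x : R) : R :=
  if Rle_dec x a then 0 else real (major_inf f a x).

Definition null_set (E : R -> Prop) : Prop :=
  forall eps, 0 < eps -> exists c d : nat -> R,
    (forall i, c i <= d i) /\
    (forall x, E x -> exists i, c i < x < d i) /\
    (forall N, sum_f_R0 (fun i => d i - c i) N <= eps).

Definition ae_on (a b : R) (P : R -> Prop) : Prop :=
  null_set (fun x => a <= x <= b /\ ~ P x).

Definition equiabs_cont (F : nat -> R -> R) (a b : R) : Prop :=
  forall eps, 0 < eps -> exists eta, 0 < eta /\
    forall (m : nat) (x y : nat -> R),
      (forall i, (i <= m)%nat -> a <= x i <= y i /\ y i <= b) ->
      (forall i j, (i <= m)%nat -> (j <= m)%nat -> i <> j ->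
          y i <= x j \/ y j <= x i) ->
      sum_f_R0 (fun i => y i - x i) m < eta ->
      forall n, sum_f_R0 (fun i => Rabs (F n (y i) - F n (x i))) m < eps.

(* Main.v *)
Require Import Defs.
From Stdlib Require Import Reals Lra Lia Classical ClassicalEpsilon.
From Coquelicot Require Import Coquelicot.
Open Scope R_scope.

(* A continuous function attains its maximum over an interval, and a right Laplace derivate is not
   positive there; hence a function with nonnegative lower derivates is nondecreasing. This makes
   the upper integral subadditive, and even countably subadditive on nonnegative functions, since
   a convergent sum of nondecreasing major functions is a major function of the sum. Null sets and
   monotone convergence follow directly. If [F] and [G] are the primitives of nonnegative
   integrable [f] and [g], then [max(f, g)] is integrable and its integral is the supremum over
   partitions of the sums of [max(F(y) - F(x), G(y) - G(x))]; with the lattice operations come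
   Fatou's lemma and dominated convergence, without any measure theory.
      Put [h_n = f_n - g] and [h = f - g], both nonnegative off a null set, with primitives [H_n],
   [H]. If [f] is integrable and the integrals converge, then [h_n] tends to [h] in mean
   (Scheffe), which gives equiabsolute continuity. Conversely, apply the formula for the integral
   of [max(h_n, K)]: the partition intervals on which [H_n] grows faster than [K x] have total
   length at most [C / K], so equiabsolute continuity bounds the integrals of [(h_n - K)^+]
   uniformly in [n], and dominated convergence of the truncations [min(h_n, K)] concludes. *)

(** * Truncated Laplace transforms and lower derivates *)

(** Of the Laplace derivate, only a few properties enter: lower bounds are monotone in the
    increments, add up, scale by positive factors, depend only on small increments, and the identity
    has derivate 1. The obstacle is that lower bounds can be added but never subtracted. Hence an
    integral is carried as two upper bounds, one for [f] and one for [- f], and all cancellation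
    comes from the monotonicity of a sum of major functions of [f] and [- f]. The maximum meets the
    same obstacle: for major functions [U] of [f] and [W] of [g], the sum [U + W] is too large for
    [max(f, g)], and the least function whose increments dominate both is a supremum of partition
    sums. This construction also supplies what level sets give in the classical proof of Vitali's
    theorem: intervals selected from a partition stand in for the set where [h_n > K]. Major
    functions see the value of the integrand at every point, whereas the hypotheses hold almost
    everywhere; so the functions [h_n] and [h] are set to 0 on one common null set before anything
    is applied to them. *)

Definition LT (phi : R -> R) (d s : R) : R :=
  s ^ 2 * RInt (fun t => exp (- (s * t)) * phi t) 0 d.

(** A lower bound for the limit inferior at infinity, phrased without extended reals so that such
    bounds can be added and scaled. *)
Definition ldge (phi : R -> R) (d c : R) : Prop :=
  forall eps, 0 < eps -> exists M, forall s, M <= s -> c - eps <= LT phi d s.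

Lemma exp_continuity (s : R) : continuity (fun t => exp (- (s * t))).
Proof.
  intros t. apply derivable_continuous_pt. reg.
Qed.

Lemma LT_ex_RInt (phi : R -> R) (s a b : R) :
  continuity phi -> ex_RInt (fun t => exp (- (s * t)) * phi t) a b.
Proof.
  intros Hc. apply (ex_RInt_continuous (V := R_CompleteNormedModule)). intros t _.
  apply continuity_pt_filterlim.
  apply (continuity_pt_mult (fun t => exp (- (s * t))) phi); [apply exp_continuity | apply Hc].
Qed.

Lemma continuity_bounded (phi : R -> R) (a b : R) :
  a <= b -> continuity phi -> exists B, 0 <= B /\ forall t, a <= t <= b -> Rabs (phi t) <= B.
Proof.
  intros Hab Hc.
  destruct (continuity_ab_maj (fun t => Rabs (phi t)) a b Hab) as [m [Hm _]].
  { intros t _. apply (continuity_pt_comp phi Rabs); [apply Hc | apply Rcontinuity_abs]. }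
  exists (Rabs (phi m)). split; [apply Rabs_pos | exact Hm].
Qed.

(** Cubing [u <= exp u] at [u = s * delta / 3] produces the 27; the third power beats [s ^ 2] and
    leaves a factor [1 / s]. *)
Lemma sqr_exp_decay (delta s : R) :
  0 < delta -> 0 < s -> s ^ 2 * exp (- (s * delta)) <= 27 / delta ^ 3 / s.
Proof.
  intros Hd Hs.
  assert (He : (s * delta / 3) ^ 3 <= exp (s * delta)).
  { replace (s * delta) with (s * delta / 3 + s * delta / 3 + s * delta / 3) at 2 by field.
    rewrite !exp_plus.
    assert (0 < s * delta) by nra.
    assert (s * delta / 3 <= exp (s * delta / 3))
      by (pose proof (exp_ineq1 (s * delta / 3)); lra).
    replace (exp (s * delta / 3) * exp (s * delta / 3) * exp (s * delta / 3))
      with (exp (s * delta / 3) ^ 3) by ring.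
    apply pow_incr. lra. }
  rewrite exp_Ropp.
  assert (Hp : 0 < (s * delta / 3) ^ 3) by (apply pow_lt; assert (0 < s * delta) by nra; lra).
  apply Rle_trans with (s ^ 2 * / (s * delta / 3) ^ 3).
  - apply Rmult_le_compat_l; [nra |]. apply Rinv_le_contravar; assumption.
  - right. field. lra.
Qed.

(** This is what makes the derivate local: for large [s] only the values of [phi] near 0 count. *)
Lemma tail_vanishes (phi : R -> R) (delta d eps : R) :
  0 < delta <= d -> continuity phi -> 0 < eps ->
  exists M, forall s, M <= s ->
    Rabs (s ^ 2 * RInt (fun t => exp (- (s * t)) * phi t) delta d) <= eps.
Proof.
  intros Hd Hc He.
  destruct (continuity_bounded phi delta d) as [B [HB Hb]]; [lra | assumption |].
  set (C := 27 / delta ^ 3 * (d - delta) * B).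
  assert (HC : 0 <= C).
  { unfold C. apply Rmult_le_pos; [apply Rmult_le_pos |]; try lra.
    apply Rlt_le, Rdiv_lt_0_compat; [lra | apply pow_lt; lra]. }
  exists (C / eps + 1). intros s Hs.
  assert (Hs0 : 0 < s).
  { assert (0 <= C / eps) by (apply Rdiv_le_0_compat; lra). lra. }
  rewrite Rabs_mult, (Rabs_pos_eq (s ^ 2)) by nra.
  assert (Hi : Rabs (RInt (fun t => exp (- (s * t)) * phi t) delta d)
               <= (d - delta) * (exp (- (s * delta)) * B)).
  { apply abs_RInt_le_const; [lra | apply LT_ex_RInt; assumption |].
    intros t Ht. rewrite Rabs_mult.
    apply Rmult_le_compat; try apply Rabs_pos; [| apply Hb; assumption].
    rewrite Rabs_pos_eq by (apply Rlt_le, exp_pos).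
    destruct (Req_dec t delta) as [-> | Hn]; [lra |].
    apply Rlt_le, exp_increasing. nra. }
  apply Rle_trans with (s ^ 2 * ((d - delta) * (exp (- (s * delta)) * B))).
  { apply Rmult_le_compat_l; [nra | assumption]. }
  replace (s ^ 2 * ((d - delta) * (exp (- (s * delta)) * B)))
    with (s ^ 2 * exp (- (s * delta)) * ((d - delta) * B)) by ring.
  apply Rle_trans with (27 / delta ^ 3 / s * ((d - delta) * B)).
  { apply Rmult_le_compat_r; [apply Rmult_le_pos; lra | apply sqr_exp_decay; lra]. }
  replace (27 / delta ^ 3 / s * ((d - delta) * B)) with (C / s) by (unfold C; field; lra).
  apply Rle_div_l; [assumption |].
  assert (C / eps * eps = C) by (field; lra). nra.
Qed.

Lemma LT_split (phi : R -> R) (delta d s : R) :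
  continuity phi ->
  LT phi d s = LT phi delta s + s ^ 2 * RInt (fun t => exp (- (s * t)) * phi t) delta d.
Proof.
  intros Hc. unfold LT. rewrite <- Rmult_plus_distr_l. f_equal. symmetry.
  apply (RInt_Chasles (V := R_CompleteNormedModule)); apply LT_ex_RInt; assumption.
Qed.

Lemma LT_le (phi psi : R -> R) (d s : R) :
  0 <= d -> continuity phi -> continuity psi ->
  (forall t, 0 <= t <= d -> phi t <= psi t) -> LT phi d s <= LT psi d s.
Proof.
  intros Hd Hphi Hpsi Hle. unfold LT. apply Rmult_le_compat_l; [nra |].
  apply RInt_le; try assumption; try (apply LT_ex_RInt; assumption).
  intros t Ht. apply Rmult_le_compat_l; [apply Rlt_le, exp_pos | apply Hle; lra].
Qed.

(* With [phi = psi] this says that [ldge] does not depend on the cut-off [d]. *)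
Lemma ldge_local (phi psi : R -> R) (d d' delta c : R) :
  continuity phi -> continuity psi -> 0 < d -> 0 < d' -> 0 < delta ->
  (forall t, 0 <= t <= delta -> phi t <= psi t) ->
  ldge phi d c -> ldge psi d' c.
Proof.
  intros Hphi Hpsi Hd Hd' Hdelta Hle H eps He.
  set (m := Rmin delta (Rmin d d')).
  assert (Hm : 0 < m /\ m <= delta /\ m <= d /\ m <= d').
  { unfold m, Rmin. destruct (Rle_dec d d'), (Rle_dec delta _); lra. }
  (* One third of [eps] for the given bound, one for each of the two tails beyond [m]. *)
  destruct (H (eps / 3)) as [M1 H1]; [lra |].
  destruct (tail_vanishes phi m d (eps / 3)) as [M2 H2]; try assumption; try lra.
  destruct (tail_vanishes psi m d' (eps / 3)) as [M3 H3]; try assumption; try lra.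
  exists (Rmax M1 (Rmax M2 M3)). intros s Hs.
  assert (HM1 := Rmax_l M1 (Rmax M2 M3)). assert (HM := Rmax_r M1 (Rmax M2 M3)).
  assert (HM2 := Rmax_l M2 M3). assert (HM3 := Rmax_r M2 M3).
  specialize (H1 s). specialize (H2 s). specialize (H3 s).
  rewrite (LT_split phi m) in H1 by assumption. rewrite (LT_split psi m) by assumption.
  assert (LT phi m s <= LT psi m s)
    by (apply LT_le; try assumption; try lra; intros; apply Hle; lra).
  assert (H2' := H2 ltac:(lra)). assert (H3' := H3 ltac:(lra)).
  apply Rabs_le_between in H2'. apply Rabs_le_between in H3'.
  assert (H1' := H1 ltac:(lra)). lra.
Qed.

Lemma LT_plus (phi psi : R -> R) (d s : R) :
  continuity phi -> continuity psi ->
  LT (fun t => phi t + psi t) d s = LT phi d s + LT psi d s.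
Proof.
  intros Hphi Hpsi. unfold LT. rewrite <- Rmult_plus_distr_l. f_equal.
  rewrite <- (RInt_plus (V := R_CompleteNormedModule)) by (apply LT_ex_RInt; assumption).
  apply RInt_ext. intros t _. unfold plus; simpl. ring.
Qed.

Lemma LT_scal (k : R) (phi : R -> R) (d s : R) :
  continuity phi -> LT (fun t => k * phi t) d s = k * LT phi d s.
Proof.
  intros Hphi. unfold LT.
  rewrite (RInt_ext _ (fun t => scal k (exp (- (s * t)) * phi t))).
  - rewrite (RInt_scal (V := R_CompleteNormedModule)) by (apply LT_ex_RInt; assumption).
    unfold scal; simpl; unfold mult; simpl. ring.
  - intros t _. unfold scal; simpl; unfold mult; simpl. ring.
Qed.

Lemma LT_ext (phi psi : R -> R) (d s : R) :
  0 <= d -> (forall t, 0 <= t <= d -> phi t = psi t) -> LT phi d s = LT psi d s.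
Proof.
  intros Hd He. unfold LT. f_equal. apply RInt_ext. intros t Ht.
  rewrite Rmin_left, Rmax_right in Ht by assumption. rewrite He by lra. reflexivity.
Qed.

Lemma ldge_plus (phi psi : R -> R) (d c c' : R) :
  continuity phi -> continuity psi -> ldge phi d c -> ldge psi d c' ->
  ldge (fun t => phi t + psi t) d (c + c').
Proof.
  intros Hphi Hpsi H H' eps He.
  destruct (H (eps / 2)) as [M HM]; [lra |]. destruct (H' (eps / 2)) as [M' HM']; [lra |].
  exists (Rmax M M'). intros s Hs. rewrite LT_plus by assumption.
  assert (Ha := Rmax_l M M'). assert (Hb := Rmax_r M M').
  specialize (HM s ltac:(lra)). specialize (HM' s ltac:(lra)). lra.
Qed.

Lemma ldge_scal (k : R) (phi : R -> R) (d c : R) :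
  0 < k -> continuity phi -> ldge phi d c -> ldge (fun t => k * phi t) d (k * c).
Proof.
  intros Hk Hphi H eps He. destruct (H (eps / k)) as [M HM]; [apply Rdiv_lt_0_compat; lra |].
  exists M. intros s Hs. rewrite LT_scal by assumption.
  replace (k * c - eps) with (k * (c - eps / k)) by (field; lra).
  apply Rmult_le_compat_l; [lra | apply HM; assumption].
Qed.

Lemma ldge_le (phi : R -> R) (d c c' : R) : c' <= c -> ldge phi d c -> ldge phi d c'.
Proof.
  intros Hc H eps He. destruct (H eps He) as [M HM]. exists M. intros s Hs.
  specialize (HM s Hs). lra.
Qed.

Lemma LT_zero (d s : R) : LT (fun _ => 0) d s = 0.
Proof.
  unfold LT. rewrite (RInt_ext _ (fun _ => 0)).
  - rewrite RInt_const. unfold scal; simpl; unfold mult; simpl. ring.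
  - intros t _. apply Rmult_0_r.
Qed.

Lemma continuity_cst (k : R) : continuity (fun _ => k).
Proof. apply continuity_const. intros x y. reflexivity. Qed.

Lemma ldge_nonpos (phi : R -> R) (d delta c : R) :
  continuity phi -> 0 < d -> 0 < delta -> (forall t, 0 <= t <= delta -> phi t <= 0) ->
  ldge phi d c -> c <= 0.
Proof.
  intros Hphi Hd Hdelta Hle H.
  apply (ldge_local phi (fun _ => 0) d 1 delta c) in H; try assumption; try lra.
  - apply Rnot_lt_le. intros Hc. destruct (H (c / 2)) as [M HM]; [lra |].
    specialize (HM M (Rle_refl M)). rewrite LT_zero in HM. lra.
  - apply continuity_cst.
Qed.

Lemma ldge_nonneg (phi : R -> R) (d delta : R) :
  continuity phi -> 0 < d -> 0 < delta -> (forall t, 0 <= t <= delta -> 0 <= phi t) ->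
  ldge phi d 0.
Proof.
  intros Hphi Hd Hdelta Hle.
  apply (ldge_local (fun _ => 0) phi 1 d delta 0); try assumption; try lra.
  - apply continuity_cst.
  - intros eps He. exists 0. intros s _. rewrite LT_zero. lra.
Qed.

Lemma LT_id (s : R) : 0 < s -> LT (fun t => t) 1 s = 1 - (1 + s) * exp (- s).
Proof.
  intros Hs. unfold LT.
  rewrite (is_RInt_unique (V := R_CompleteNormedModule) _ 0 1
    (minus (- (1 / s + / s ^ 2) * exp (- (s * 1))) (- (0 / s + / s ^ 2) * exp (- (s * 0))))).
  - unfold minus, plus, opp; simpl. rewrite Rmult_0_r, Ropp_0, exp_0, !Rmult_1_r. field. lra.
  - apply (is_RInt_derive (fun t => - (t / s + / s ^ 2) * exp (- (s * t)))).
    + intros t _. auto_derive; [lra |]. field. lra.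
    + intros t _. apply continuity_pt_filterlim.
      apply (continuity_pt_mult (fun t => exp (- (s * t))) (fun t => t));
        [apply exp_continuity | apply derivable_continuous_pt; reg].
Qed.

Lemma ldge_id : ldge (fun t => t) 1 1.
Proof.
  (* Since [s >= 1], the error [(1 + s) * exp (- s)] is at most [2 * s ^ 2 * exp (- s)], hence at
     most [2 * 27 / s]. *)
  intros eps He. exists (54 / eps + 1). intros s Hs.
  assert (0 < 54 / eps) by (apply Rdiv_lt_0_compat; lra).
  rewrite LT_id by lra.
  assert (Hdec := sqr_exp_decay 1 s ltac:(lra) ltac:(lra)).
  rewrite Rmult_1_r, pow1, Rdiv_1_r in Hdec.
  assert (Hp := exp_pos (- s)).
  assert (Hsm : 54 / s <= eps).
  { apply Rle_div_l; [lra |]. assert (54 / eps * eps = 54) by (field; lra). nra. }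
  assert ((1 + s) * exp (- s) <= 2 * (s ^ 2 * exp (- s))).
  { rewrite <- Rmult_assoc. apply Rmult_le_compat_r; nra. }
  lra.
Qed.

Lemma ldge_opp_id : ldge (fun t => - t) 1 (-1).
Proof.
  (* The error term now has the favourable sign, so no decay estimate enters. *)
  intros eps He. exists 1. intros s Hs.
  rewrite (LT_ext _ (fun t => -1 * t)) by (intros; lra).
  rewrite LT_scal by (apply derivable_continuous; reg). rewrite LT_id by lra.
  assert (Hp := exp_pos (- s)). nra.
Qed.

(** * Major functions and upper integrals *)

(* The cut-off is fixed to [1] and [U] is continuous on the whole line: by [ldge_local] this loses
   nothing, and restriction to subintervals becomes trivial. Minor functions of [f] are the
   opposites of major functions of [-f]. *)
Definition maj (f U : R -> R) (a b : R) : Prop :=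
  continuity U /\
  forall x, a <= x <= b ->
    (x < b -> ldge (fun t => U (x + t) - U x) 1 (f x)) /\
    (a < x -> ldge (fun t => U x - U (x - t)) 1 (f x)).

(** Composition with [clamp a b] extends a function from [[a, b]] to the line by constants; it links
    continuity on an interval with continuity everywhere. *)
Definition clamp (a b x : R) : R := Rmax a (Rmin b x).

Ltac clamp_cases :=
  intros; unfold clamp, Rmin;
  repeat match goal with |- context [Rle_dec ?u ?v] => destruct (Rle_dec u v) end;
  unfold Rmax;
  repeat match goal with |- context [Rle_dec ?u ?v] => destruct (Rle_dec u v) end.

Lemma clamp_in (a b x : R) : a <= b -> a <= clamp a b x <= b.
Proof. clamp_cases; lra. Qed.

Lemma clamp_id (a b x : R) : a <= x <= b -> clamp a b x = x.
Proof. clamp_cases; lra. Qed.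

Lemma clamp_ge (a b x : R) : a <= b <= x -> clamp a b x = b.
Proof. clamp_cases; lra. Qed.

Lemma clamp_le (a b x : R) : x <= a <= b -> clamp a b x = a.
Proof. clamp_cases; lra. Qed.

Lemma clamp_mono (a b x y : R) : a <= b -> x <= y -> clamp a b x <= clamp a b y.
Proof. clamp_cases; lra. Qed.

Lemma clamp_lip (a b x y : R) : a <= b -> Rabs (clamp a b x - clamp a b y) <= Rabs (x - y).
Proof. clamp_cases; apply Rabs_le; pose proof (Rle_abs (x - y)); pose proof (Rle_abs (- (x - y)));
  rewrite Rabs_Ropp in *; lra. Qed.

(** Because [G] may depend on [eps], this covers uniform limits of continuous functions as well as
    functions whose increments are dominated by those of a single continuous one. *)
Lemma continuity_modulus (U : R -> R) :
  (forall eps, 0 < eps -> exists G, continuity G /\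
     forall x y, Rabs (U x - U y) <= Rabs (G x - G y) + eps) ->
  continuity U.
Proof.
  intros H x eps He. destruct (H (eps / 2)) as [G [HG Hle]]; [lra |].
  destruct (HG x (eps / 2)) as [alp [Ha Hb]]; [lra |].
  exists alp. split; [assumption |]. intros y Hy. specialize (Hb y Hy).
  specialize (Hle y x). simpl in *. unfold R_dist in *. lra.
Qed.

Lemma continuity_clamp (a b : R) : a <= b -> continuity (clamp a b).
Proof.
  intros Hab. apply continuity_modulus. intros eps He. exists (fun x => x).
  split; [apply derivable_continuous; reg |].
  intros x y. pose proof (clamp_lip a b x y Hab). lra.
Qed.

Lemma continuity_comp_clamp (U : R -> R) (a b : R) :
  a <= b -> continuity U -> continuity (fun x => U (clamp a b x)).
Proof. intros Hab HU. apply (continuity_comp (clamp a b) U); [apply continuity_clamp |]; assumption. Qed.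

Lemma continuity_incr_r (U : R -> R) (x : R) : continuity U -> continuity (fun t => U (x + t) - U x).
Proof.
  intros HU. apply continuity_minus; [| apply continuity_cst].
  apply (continuity_comp (fun t => x + t) U); [apply derivable_continuous; reg | assumption].
Qed.

Lemma continuity_incr_l (U : R -> R) (x : R) : continuity U -> continuity (fun t => U x - U (x - t)).
Proof.
  intros HU. apply continuity_minus; [apply continuity_cst |].
  apply (continuity_comp (fun t => x - t) U); [apply derivable_continuous; reg | assumption].
Qed.

(** Derivates at a point of [[a, b]] depend only on small increments, and these can be kept inside
    the interval; larger increments give larger derivates. *)
Lemma maj_incr_le (f g U W : R -> R) (a b : R) :
  continuity W -> maj f U a b ->
  (forall x, a <= x <= b -> g x <= f x) ->
  (forall x y, a <= x <= y -> y <= b -> U y - U x <= W y - W x) ->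
  maj g W a b.
Proof.
  intros HW [HU Hm] Hgf Hinc. split; [assumption |]. intros x Hx.
  destruct (Hm x Hx) as [Hr Hl]. split; intros Hxb.
  - apply (ldge_local (fun t => U (x + t) - U x) _ 1 1 (b - x)); try lra;
      try (apply continuity_incr_r; assumption).
    + intros t Ht. apply Hinc; lra.
    + apply ldge_le with (f x); auto.
  - apply (ldge_local (fun t => U x - U (x - t)) _ 1 1 (x - a)); try lra;
      try (apply continuity_incr_l; assumption).
    + intros t Ht. apply Hinc; lra.
    + apply ldge_le with (f x); auto.
Qed.

Lemma maj_mono (f g U : R -> R) (a b : R) :
  (forall x, a <= x <= b -> g x <= f x) -> maj f U a b -> maj g U a b.
Proof.
  intros Hgf Hm. apply (maj_incr_le f g U U a b); try assumption; [apply Hm |]. intros; lra.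
Qed.

Lemma maj_restrict (f U : R -> R) (a b c d : R) :
  a <= c -> d <= b -> maj f U a b -> maj f U c d.
Proof.
  intros Hac Hdb [HU Hm]. split; [assumption |]. intros x Hx.
  destruct (Hm x) as [Hr Hl]; [lra |]. split; intros; [apply Hr | apply Hl]; lra.
Qed.

Lemma maj_plus (f g U W : R -> R) (a b : R) :
  maj f U a b -> maj g W a b -> maj (fun x => f x + g x) (fun x => U x + W x) a b.
Proof.
  intros [HU Hf] [HW Hg]. split; [apply (continuity_plus U W); assumption |].
  intros x Hx. destruct (Hf x Hx) as [Hfr Hfl], (Hg x Hx) as [Hgr Hgl]. split; intros Hb.
  - apply (ldge_local (fun t => (U (x + t) - U x) + (W (x + t) - W x)) _ 1 1 1); try lra.
    + apply (continuity_plus (fun t => U (x + t) - U x)); apply continuity_incr_r; assumption.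
    + apply (continuity_incr_r (fun x => U x + W x)), (continuity_plus U W); assumption.
    + intros; lra.
    + apply ldge_plus; try apply continuity_incr_r; auto.
  - apply (ldge_local (fun t => (U x - U (x - t)) + (W x - W (x - t))) _ 1 1 1); try lra.
    + apply (continuity_plus (fun t => U x - U (x - t))); apply continuity_incr_l; assumption.
    + apply (continuity_incr_l (fun x => U x + W x)), (continuity_plus U W); assumption.
    + intros; lra.
    + apply ldge_plus; try apply continuity_incr_l; auto.
Qed.

Lemma maj_scal (k : R) (f U : R -> R) (a b : R) :
  0 < k -> maj f U a b -> maj (fun x => k * f x) (fun x => k * U x) a b.
Proof.
  intros Hk [HU Hf].
  assert (Hc : continuity (fun x => k * U x))
    by (apply (continuity_mult (fun _ => k) U); [apply continuity_cst | assumption]).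
  split; [assumption |].
  intros x Hx. destruct (Hf x Hx) as [Hfr Hfl]. split; intros Hb.
  - apply (ldge_local (fun t => k * (U (x + t) - U x)) _ 1 1 1); try lra.
    + apply (continuity_mult (fun _ => k)); [apply continuity_cst | apply continuity_incr_r; assumption].
    + apply (continuity_incr_r (fun x => k * U x)); assumption.
    + intros; lra.
    + apply ldge_scal; try apply continuity_incr_r; auto.
  - apply (ldge_local (fun t => k * (U x - U (x - t))) _ 1 1 1); try lra.
    + apply (continuity_mult (fun _ => k)); [apply continuity_cst | apply continuity_incr_l; assumption].
    + apply (continuity_incr_l (fun x => k * U x)); assumption.
    + intros; lra.
    + apply ldge_scal; try apply continuity_incr_l; auto.
Qed.

Lemma maj_zero (a b : R) : maj (fun _ => 0) (fun _ => 0) a b.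
Proof.
  split; [apply continuity_cst |].
  intros x _. split; intros _; apply (ldge_nonneg _ 1 1); try lra;
    try (intros; lra); apply (continuity_minus (fun _ => 0)); apply continuity_cst.
Qed.

Lemma maj_id (a b : R) : maj (fun _ => 1) (fun x => x) a b.
Proof.
  assert (Hc : continuity (fun x : R => x)) by (apply derivable_continuous; reg).
  split; [assumption |]. intros x _.
  split; intros _; apply (ldge_local (fun t => t) _ 1 1 1); try lra; try assumption;
    try apply ldge_id; try (intros; lra).
  - apply (continuity_incr_r (fun x => x)); assumption.
  - apply (continuity_incr_l (fun x => x)); assumption.
Qed.

Lemma maj_opp_id (a b : R) : maj (fun _ => -1) (fun x => - x) a b.
Proof.
  assert (Hc : continuity (fun x : R => - x)) by (apply derivable_continuous; reg).
  split; [assumption |]. intros x _.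
  split; intros _; apply (ldge_local (fun t => - t) _ 1 1 1); try lra; try assumption;
    try apply ldge_opp_id; try (intros; lra).
  - apply (continuity_incr_r (fun x => - x)); assumption.
  - apply (continuity_incr_l (fun x => - x)); assumption.
Qed.

(* At a maximum [z < y] of [U] on [[x, y]] the right increments are nonpositive, which contradicts
   a positive lower right derivate. *)
Lemma maj_pos_increasing (f U : R -> R) (a b x y : R) :
  maj f U a b -> (forall z, a <= z <= b -> 0 < f z) ->
  a <= x <= y -> y <= b -> U x <= U y.
Proof.
  intros [HU Hm] Hf Hx Hy. apply Rnot_lt_le. intros Hlt.
  destruct (continuity_ab_maj U x y) as [z [Hmax Hz]]; [lra | intros; apply HU |].
  assert (Hzy : z < y).
  { destruct (Req_dec z y) as [-> | Hn]; [| lra]. specialize (Hmax x). lra. }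
  destruct (Hm z) as [Hr _]; [lra |]. specialize (Hr ltac:(lra)).
  apply (ldge_nonpos _ _ (y - z)) in Hr; try lra.
  - specialize (Hf z). lra.
  - apply continuity_incr_r; assumption.
  - intros t Ht. specialize (Hmax (z + t)). lra.
Qed.

Lemma maj_increasing (f U : R -> R) (a b x y : R) :
  maj f U a b -> (forall z, a <= z <= b -> 0 <= f z) ->
  a <= x <= y -> y <= b -> U x <= U y.
Proof.
  intros Hm Hf Hx Hy. apply Rnot_lt_le. intros Hlt.
  (* Adding [k * x] makes the derivates strictly positive, while [k * (y - x)] stays below half of
     the supposed drop [U x - U y]. The [+ 1] keeps the denominator positive when [x = y]. *)
  set (k := (U x - U y) / (2 * (y - x + 1))).
  assert (Hk : 0 < k) by (apply Rdiv_lt_0_compat; lra).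
  assert (H : U x + k * x <= U y + k * y).
  { apply (maj_pos_increasing (fun x => f x + k * 1) (fun x => U x + k * x) a b); try lra.
    - apply maj_plus; [assumption |]. apply (maj_scal k (fun _ => 1)), maj_id; assumption.
    - intros z Hz. specialize (Hf z Hz). lra. }
  assert (k * (y - x + 1) = (U x - U y) / 2) by (unfold k; field; lra).
  nra.
Qed.

(** At the joint [c] the left derivate is that of [U] and the right one that of [W]; both are
    controlled because [maj] bounds the inward derivate at an end point. *)
Lemma maj_glue (f U W : R -> R) (a b c : R) :
  a <= c <= b -> maj f U a c -> maj f W c b ->
  maj f (fun x => U (clamp a c x) + (W (clamp c b x) - W c)) a b.
Proof.
  intros Hc [HU Hf] [HW Hg].
  set (G := fun x => U (clamp a c x) + (W (clamp c b x) - W c)).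
  assert (HG : continuity G).
  { apply (continuity_plus (fun x => U (clamp a c x))).
    - apply continuity_comp_clamp; [lra | assumption].
    - apply (continuity_minus (fun x => W (clamp c b x))); [| apply continuity_cst].
      apply continuity_comp_clamp; [lra | assumption]. }
  assert (GU : forall x, a <= x <= c -> G x = U x).
  { intros x Hx. unfold G. rewrite clamp_id, clamp_le by lra. lra. }
  assert (GW : forall x, c <= x <= b -> G x = U c + (W x - W c)).
  { intros x Hx. unfold G. rewrite clamp_ge, clamp_id by lra. lra. }
  split; [assumption |]. intros x Hx. split; intros Hb.
  - destruct (Rlt_le_dec x c) as [Hxc | Hxc].
    + apply (ldge_local (fun t => U (x + t) - U x) _ 1 1 (c - x)); try lra;
        try (apply continuity_incr_r; assumption).
      * intros t Ht. rewrite !GU by lra. lra.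
      * apply Hf; lra.
    + apply (ldge_local (fun t => W (x + t) - W x) _ 1 1 (b - x)); try lra;
        try (apply continuity_incr_r; assumption).
      * intros t Ht. rewrite !GW by lra. lra.
      * apply Hg; lra.
  - destruct (Rle_lt_dec x c) as [Hxc | Hxc].
    + apply (ldge_local (fun t => U x - U (x - t)) _ 1 1 (x - a)); try lra;
        try (apply continuity_incr_l; assumption).
      * intros t Ht. rewrite !GU by lra. lra.
      * apply Hf; lra.
    + apply (ldge_local (fun t => W x - W (x - t)) _ 1 1 (x - c)); try lra;
        try (apply continuity_incr_l; assumption).
      * intros t Ht. rewrite !GW by lra. lra.
      * apply Hg; lra.
Qed.

(* The upper integral of [f] over [[a, b]] is at most [v]. *)
Definition upper_le (f : R -> R) (a b v : R) : Prop :=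
  forall eps, 0 < eps -> exists U, maj f U a b /\ U b - U a <= v + eps.

(** The second bound says that the lower integral is at least [v]; [upper_opp] shows that the two
    bounds determine [v]. *)
Definition integ (f : R -> R) (a b v : R) : Prop :=
  upper_le f a b v /\ upper_le (fun x => - f x) a b (- v).

(** * Calculus of upper integrals and of the integral *)

Lemma upper_mono (f g : R -> R) (a b v w : R) :
  (forall x, a <= x <= b -> f x <= g x) -> v <= w -> upper_le g a b v -> upper_le f a b w.
Proof.
  intros Hfg Hvw H eps He. destruct (H eps He) as [U [HU Hv]]. exists U.
  split; [apply maj_mono with g; assumption | lra].
Qed.

Lemma upper_plus (f g : R -> R) (a b v w : R) :
  upper_le f a b v -> upper_le g a b w -> upper_le (fun x => f x + g x) a b (v + w).
Proof.
  intros Hf Hg eps He. destruct (Hf (eps / 2)) as [U [HU Hv]]; [lra |].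
  destruct (Hg (eps / 2)) as [W [HW Hw]]; [lra |].
  exists (fun x => U x + W x). split; [apply maj_plus; assumption | lra].
Qed.

Lemma upper_scal (k : R) (f : R -> R) (a b v : R) :
  0 < k -> upper_le f a b v -> upper_le (fun x => k * f x) a b (k * v).
Proof.
  intros Hk H eps He. destruct (H (eps / k)) as [U [HU Hv]]; [apply Rdiv_lt_0_compat; lra |].
  exists (fun x => k * U x). split; [apply maj_scal; assumption |].
  apply Rmult_le_compat_l with (r := k) in Hv; [| lra].
  replace (k * (v + eps / k)) with (k * v + eps) in Hv by (field; lra). lra.
Qed.

Lemma upper_zero (a b : R) : upper_le (fun _ => 0) a b 0.
Proof. intros eps He. exists (fun _ => 0). split; [apply maj_zero | lra]. Qed.

Lemma upper_limit (f : R -> R) (a b v : R) :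
  (forall eps, 0 < eps -> upper_le f a b (v + eps)) -> upper_le f a b v.
Proof.
  intros H eps He. destruct (H (eps / 2) ltac:(lra) (eps / 2) ltac:(lra)) as [U [HU Hv]].
  exists U. split; [assumption | lra].
Qed.

(** Major functions of [f] and of [- f] add up to a major function of 0, which is nondecreasing. *)
Lemma upper_opp (f : R -> R) (a b v w : R) :
  a <= b -> upper_le f a b v -> upper_le (fun x => - f x) a b w -> 0 <= v + w.
Proof.
  intros Hab Hv Hw. apply Rnot_lt_le. intros Hlt.
  destruct (upper_plus _ _ _ _ _ _ Hv Hw (- (v + w) / 2)) as [U [HU Hu]]; [lra |].
  assert (U a <= U b) by (apply (maj_increasing _ U a b a b HU); intros; lra). lra.
Qed.

Lemma upper_glue (f : R -> R) (a b c v w : R) :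
  a <= c <= b -> upper_le f a c v -> upper_le f c b w -> upper_le f a b (v + w).
Proof.
  intros Hc Hv Hw eps He. destruct (Hv (eps / 2)) as [U [HU Hu]]; [lra |].
  destruct (Hw (eps / 2)) as [W [HW Hw']]; [lra |].
  exists (fun x => U (clamp a c x) + (W (clamp c b x) - W c)).
  split; [apply maj_glue; assumption |].
  rewrite (clamp_ge a c b), (clamp_id c b b), (clamp_id a c a), (clamp_le c b a) by lra. lra.
Qed.

Lemma integ_unique (f : R -> R) (a b v w : R) :
  a <= b -> integ f a b v -> integ f a b w -> v = w.
Proof.
  intros Hab [H1 H2] [H3 H4].
  assert (0 <= v + - w) by (apply (upper_opp f a b); assumption).
  assert (0 <= w + - v) by (apply (upper_opp f a b); assumption). lra.
Qed.

Lemma integ_ext (f g : R -> R) (a b v : R) :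
  (forall x, a <= x <= b -> f x = g x) -> integ f a b v -> integ g a b v.
Proof.
  intros He [H1 H2]. split; [apply (upper_mono _ f _ _ v) | apply (upper_mono _ (fun x => - f x) _ _ (- v))];
    try assumption; try lra; intros x Hx; rewrite (He x Hx); lra.
Qed.

Lemma integ_le (f g : R -> R) (a b v w : R) :
  a <= b -> (forall x, a <= x <= b -> f x <= g x) -> integ f a b v -> integ g a b w -> v <= w.
Proof.
  intros Hab Hfg [_ H2] [H3 _].
  apply (upper_mono f g _ _ w w) in H3; try assumption; try lra.
  assert (0 <= w + - v) by (apply (upper_opp f a b); assumption). lra.
Qed.

Lemma integ_plus (f g : R -> R) (a b v w : R) :
  integ f a b v -> integ g a b w -> integ (fun x => f x + g x) a b (v + w).
Proof.
  intros [H1 H2] [H3 H4]. split; [apply upper_plus; assumption |].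
  apply (upper_mono _ (fun x => - f x + - g x) _ _ (- v + - w)); [intros; lra | lra |].
  apply upper_plus; assumption.
Qed.

Lemma integ_opp (f : R -> R) (a b v : R) : integ f a b v -> integ (fun x => - f x) a b (- v).
Proof.
  intros [H1 H2]. split; [assumption |].
  apply (upper_mono _ f _ _ v); [intros; lra | lra | assumption].
Qed.

Lemma integ_minus (f g : R -> R) (a b v w : R) :
  integ f a b v -> integ g a b w -> integ (fun x => f x - g x) a b (v - w).
Proof. intros Hf Hg. apply integ_plus; [| apply integ_opp]; assumption. Qed.

Lemma integ_scal (k : R) (f : R -> R) (a b v : R) :
  0 < k -> integ f a b v -> integ (fun x => k * f x) a b (k * v).
Proof.
  intros Hk [H1 H2]. split; [apply upper_scal; assumption |].
  apply (upper_mono _ (fun x => k * - f x) _ _ (k * - v)); [intros; lra | lra |].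
  apply upper_scal; assumption.
Qed.

Lemma integ_const (k a b : R) : 0 < k -> integ (fun _ => k) a b (k * (b - a)).
Proof.
  intros Hk. apply (integ_ext (fun _ => k * 1)); [intros; lra |].
  apply (integ_scal k (fun _ => 1)); [assumption |]. split; intros eps He.
  - exists (fun x => x). split; [apply maj_id | lra].
  - exists (fun x => - x). split; [apply maj_opp_id | lra].
Qed.

Lemma integ_zero (a b : R) : integ (fun _ => 0) a b 0.
Proof.
  split; [apply upper_zero |].
  apply (upper_mono _ (fun _ => 0) _ _ 0); [intros; lra | lra | apply upper_zero].
Qed.

(** For major functions [U] of [f] and [W] of [- f], the sum [U + W] is nondecreasing, so its
    increment over a subinterval is at most that over [[a, b]], which can be made arbitrarily
    small. *)
Lemma integ_split (f : R -> R) (a b c v : R) :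
  a <= c <= b -> integ f a b v -> exists u, integ f a c u /\ integ f c b (v - u).
Proof.
  intros Hc [H1 H2].
  assert (Hinc : forall U W x y, maj f U a b -> maj (fun x => - f x) W a b ->
            a <= x <= y -> y <= b -> U x + W x <= U y + W y).
  { intros U W x y HU HW Hx Hy.
    apply (maj_increasing _ (fun x => U x + W x) a b x y (maj_plus _ _ _ _ _ _ HU HW)); try assumption.
    intros; lra. }
  destruct (H2 1) as [W1 [HW1 _]]; [lra |]. destruct (H1 1) as [U1 [HU1 _]]; [lra |].
  (* [completeness] gives suprema, so the infimum of [U c - U a] over the major functions on all of
     [[a, b]] appears as [- m]. *)
  destruct (completeness (fun r => exists U, maj f U a b /\ r = - (U c - U a))) as [m [Hub Hlub]].
  { exists (W1 c - W1 a). intros r [U [HU ->]]. specialize (Hinc U W1 a c HU HW1). lra. }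
  { exists (- (U1 c - U1 a)), U1. split; [assumption | reflexivity]. }
  assert (Hm : forall U, maj f U a b -> - m <= U c - U a).
  { intros U HU. specialize (Hub (- (U c - U a))). apply Ropp_le_cancel.
    rewrite Ropp_involutive. apply Hub. exists U. split; [assumption | reflexivity]. }
  assert (Happ : forall eps, 0 < eps -> exists U, maj f U a b /\ U c - U a <= - m + eps).
  { intros eps He. apply NNPP. intros Hn. apply (Rlt_irrefl m).
    apply Rle_lt_trans with (m - eps); [| lra]. apply Hlub. intros r [U [HU ->]].
    apply Rnot_lt_le. intros Hlt. apply Hn. exists U. split; [assumption | lra]. }
  assert (HW : forall W, maj (fun x => - f x) W a b -> m <= W c - W a).
  { intros W HW. apply Hlub. intros r [U [HU ->]]. specialize (Hinc U W a c HU HW). lra. }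
  exists (- m). split; split; intros eps He.
  - destruct (Happ eps He) as [U [HU Hu]]. exists U. split; [| assumption].
    apply maj_restrict with a b; try assumption; lra.
  - destruct (H2 (eps / 2)) as [W [HW' Hw]]; [lra |]. destruct (H1 (eps / 2)) as [U [HU Hu]]; [lra |].
    exists W. split; [apply maj_restrict with a b; try assumption; lra |].
    specialize (Hm U HU). specialize (Hinc U W c b HU HW'). lra.
  - destruct (H1 eps He) as [U [HU Hu]]. exists U.
    split; [apply maj_restrict with a b; try assumption; lra |]. specialize (Hm U HU). lra.
  - destruct (H2 eps He) as [W [HW' Hw]]. exists W.
    split; [apply maj_restrict with a b; try assumption; lra |]. specialize (HW W HW'). lra.
Qed.

(** * Countable subadditivity, null sets, monotone convergence *)

Lemma ldge_limit (phi : R -> R) (d c : R) :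
  (forall eps, 0 < eps -> ldge phi d (c - eps)) -> ldge phi d c.
Proof.
  intros H eps He. destruct (H (eps / 2) ltac:(lra) (eps / 2) ltac:(lra)) as [M HM].
  exists M. intros s Hs. specialize (HM s Hs). lra.
Qed.

Lemma maj_sum (fs U : nat -> R -> R) (a b : R) (N : nat) :
  (forall n, maj (fs n) (U n) a b) ->
  maj (fun x => sum_f_R0 (fun k => fs k x) N) (fun x => sum_f_R0 (fun k => U k x) N) a b.
Proof.
  intros H. induction N as [| N IH]; simpl; [apply H |]. apply maj_plus; [assumption | apply H].
Qed.

Lemma sum_f_R0_incr (u v : nat -> R) (M N : nat) :
  (forall k, u k <= v k) -> (M <= N)%nat ->
  sum_f_R0 v M - sum_f_R0 u M <= sum_f_R0 v N - sum_f_R0 u N.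
Proof.
  intros Huv HMN. induction HMN as [| N HMN IH]; [lra |]. simpl. specialize (Huv (S N)). lra.
Qed.

Lemma sum_half_pow (eps : R) (N : nat) :
  0 < eps -> sum_f_R0 (fun k => eps / 2 ^ (S k)) N <= eps.
Proof.
  intros He. assert (H : sum_f_R0 (fun k => eps / 2 ^ (S k)) N = eps - eps / 2 ^ (S N)).
  { induction N as [| N IH]; [simpl; field |].
    rewrite tech5, IH. assert (2 ^ N <> 0) by (apply pow_nonzero; lra). simpl. field. assumption. }
  rewrite H. assert (0 < eps / 2 ^ (S N)) by (apply Rdiv_lt_0_compat; [lra | apply pow_lt; lra]). lra.
Qed.

Lemma Un_cv_ge_eventually (u : nat -> R) (l c : R) (N : nat) :
  Un_cv u l -> (forall n, (N <= n)%nat -> c <= u n) -> c <= l.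
Proof.
  intros Hu Hc. apply Rnot_lt_le. intros Hlt. destruct (Hu (c - l)) as [M HM]; [lra |].
  specialize (HM (max M N) ltac:(lia)). specialize (Hc (max M N) ltac:(lia)).
  unfold R_dist in HM. apply Rabs_lt_between in HM. lra.
Qed.

(* The sum of nondecreasing major functions of the terms is a major function of the sum, because
   the tails only increase the difference quotients. *)
Lemma upper_series (fs : nat -> R -> R) (v : nat -> R) (f : R -> R) (a b V : R) :
  a <= b ->
  (forall n x, a <= x <= b -> 0 <= fs n x) ->
  (forall n, upper_le (fs n) a b (v n)) ->
  (forall N, sum_f_R0 v N <= V) ->
  (forall x, a <= x <= b -> forall eps, 0 < eps -> exists N, f x - eps <= sum_f_R0 (fun k => fs k x) N) ->
  upper_le f a b V.
Proof.
  intros Hab Hpos Hup HV Hf eps He.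
  assert (Hch : forall k, exists U, maj (fs k) U a b /\ U b - U a <= v k + eps / 2 ^ (S k)).
  { intros k. apply Hup. apply Rdiv_lt_0_compat; [lra | apply pow_lt; lra]. }
  pose (Uk k := proj1_sig (constructive_indefinite_description _ (Hch k))).
  assert (HUk : forall k, maj (fs k) (Uk k) a b /\ Uk k b - Uk k a <= v k + eps / 2 ^ (S k)).
  { intros k. exact (proj2_sig (constructive_indefinite_description _ (Hch k))). }
  clearbody Uk. clear Hch.
  (* Normalised to vanish at [a] and to be nondecreasing on the whole line, so that the partial sums
     increase and are bounded by their values at [b]. *)
  pose (P k x := Uk k (clamp a b x) - Uk k a).
  assert (HPc : forall k, continuity (P k)).
  { intros k. apply (continuity_minus (fun x => Uk k (clamp a b x))); [| apply continuity_cst].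
    apply continuity_comp_clamp; [assumption | apply HUk]. }
  assert (HPm : forall k, maj (fs k) (P k) a b).
  { intros k. apply (maj_incr_le (fs k) _ (Uk k)); [apply HPc | apply HUk | intros; lra |].
    intros x y Hx Hy. unfold P. rewrite !clamp_id by lra. lra. }
  assert (HPi : forall k x y, x <= y -> P k x <= P k y).
  { intros k x y Hxy. unfold P.
    destruct (clamp_in a b x Hab), (clamp_in a b y Hab). assert (Hc := clamp_mono a b x y Hab Hxy).
    assert (Uk k (clamp a b x) <= Uk k (clamp a b y)); [| lra].
    apply (maj_increasing (fs k) _ a b); [apply HUk | apply Hpos | lra | lra]. }
  assert (HPa : forall k, P k a = 0) by (intros k; unfold P; rewrite clamp_id by lra; lra).
  assert (HPb : forall k, P k b <= v k + eps / 2 ^ (S k))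
    by (intros k; unfold P; rewrite clamp_id by lra; apply HUk).
  assert (HPcl : forall k x, P k x = P k (clamp a b x)).
  { intros k x. unfold P. rewrite (clamp_id a b (clamp a b x)) by (apply clamp_in; assumption).
    reflexivity. }
  pose (T N x := sum_f_R0 (fun k => P k x) N).
  assert (HTb : forall N, T N b <= V + eps).
  { intros N. unfold T. apply Rle_trans with (sum_f_R0 (fun k => v k + eps / 2 ^ (S k)) N).
    - apply sum_Rle. intros; apply HPb.
    - rewrite sum_plus. pose proof (sum_half_pow eps N He). specialize (HV N). lra. }
  assert (HTcl : forall N x, T N x = T N (clamp a b x)).
  { intros N x. unfold T. apply sum_eq. intros; apply HPcl. }
  assert (HTi : forall M N x y, x <= y -> (M <= N)%nat -> T M y - T M x <= T N y - T N x).
  { intros M N x y Hxy HMN.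
    apply (sum_f_R0_incr (fun k => P k x) (fun k => P k y)); [intros; apply HPi |]; assumption. }
  assert (HTa : forall N, T N a = 0).
  { intros N. unfold T. rewrite (sum_eq _ (fun _ => 0)) by (intros; apply HPa).
    rewrite sum_cte. ring. }
  assert (HT0 : forall N x y, x <= y -> T N x <= T N y).
  { intros N x y Hxy. apply sum_Rle. intros; apply HPi; assumption. }
  assert (Hcv : forall x, { l | Un_cv (fun N => T N x) l }).
  { intros x. apply growing_cv.
    - intros N. rewrite (HTcl N), (HTcl (S N)).
      destruct (clamp_in a b x Hab).
      pose proof (HTi N (S N) a (clamp a b x) ltac:(lra) ltac:(lia)). rewrite !HTa in *. lra.
    - exists (V + eps). intros r [N ->]. rewrite HTcl. destruct (clamp_in a b x Hab).
      apply Rle_trans with (T N b); [apply HT0; lra | apply HTb]. }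
  pose (U x := proj1_sig (Hcv x)).
  assert (HU : forall x, Un_cv (fun N => T N x) (U x)) by (intros x; exact (proj2_sig (Hcv x))).
  clearbody U. clear Hcv.
  (* Each difference [U - T N] is nondecreasing: this carries the derivates of the partial sums over
     to [U], and it also makes the convergence uniform. *)
  assert (HUT : forall N x y, x <= y -> T N y - T N x <= U y - U x).
  { intros N x y Hxy. apply (Un_cv_ge_eventually (fun M => T M y - T M x) _ _ N).
    - apply CV_minus; apply HU.
    - intros M HM. apply HTi; assumption. }
  assert (HUa : U a = 0).
  { apply (UL_sequence (fun N => T N a)); [apply HU |]. intros r Hr. exists 0%nat. intros n _.
    rewrite HTa. unfold R_dist. rewrite Rminus_0_r, Rabs_R0. assumption. }
  assert (HUcl : forall x, U x = U (clamp a b x)).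
  { intros x. apply (UL_sequence (fun N => T N x)); [apply HU |].
    intros r Hr. destruct (HU (clamp a b x) r Hr) as [N HN]. exists N. intros n Hn.
    rewrite HTcl. apply HN; assumption. }
  assert (HUc : continuity U).
  (* The nondecreasing function [U - T N] vanishes at [a]; once it is below [r] at [b], it is below
     [r] everywhere. *)
  { apply continuity_modulus. intros r Hr. destruct (HU b r Hr) as [N HN].
    exists (T N). split.
    - unfold T. clear - HPc. induction N as [| N IH]; simpl; [apply HPc |].
      apply (continuity_plus (fun x => sum_f_R0 (fun k => P k x) N)); [assumption | apply HPc].
    - specialize (HN N (le_n N)). unfold R_dist in HN. rewrite Rabs_minus_sym in HN.
      assert (Hw : forall x y, x <= y -> 0 <= U y - U x <= T N y - T N x + r).
      { intros x y Hxy. rewrite (HUcl x), (HUcl y), (HTcl N x), (HTcl N y).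
        assert (Hc := clamp_mono a b x y Hab Hxy).
        destruct (clamp_in a b x Hab), (clamp_in a b y Hab).
        pose proof (HUT N _ _ Hc). pose proof (HT0 N _ _ Hc).
        pose proof (HUT N (clamp a b y) b ltac:(lra)).
        pose proof (HUT N a (clamp a b x) ltac:(lra)). rewrite HTa, HUa in *.
        apply Rabs_lt_between in HN. lra. }
      intros x y. destruct (Rle_dec x y) as [Hxy | Hxy].
      + specialize (Hw x y Hxy). rewrite (Rabs_minus_sym (U x)), (Rabs_minus_sym (T N x)).
        pose proof (HT0 N x y Hxy). rewrite !Rabs_pos_eq by lra. lra.
      + specialize (Hw y x ltac:(lra)). pose proof (HT0 N y x ltac:(lra)).
        rewrite !Rabs_pos_eq by lra. lra. }
  exists U. split; [| rewrite HUa].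
  (* At each point one partial sum within [r] of [f x] is enough, so the series of the [fs k x] may
     diverge there. *)
  - split; [assumption |]. intros x Hx.
    split; intros Hb; apply ldge_limit; intros r Hr; destruct (Hf x Hx r Hr) as [N HN];
      destruct (maj_sum fs P a b N HPm) as [HSc HS]; destruct (HS x Hx) as [HSr HSl].
    + apply (ldge_local (fun t => T N (x + t) - T N x) _ 1 1 1); try lra;
        try (apply continuity_incr_r; assumption).
      * intros t Ht. apply HUT. lra.
      * eapply ldge_le; [exact HN | auto].
    + apply (ldge_local (fun t => T N x - T N (x - t)) _ 1 1 1); try lra;
        try (apply continuity_incr_l; assumption).
      * intros t Ht. apply HUT. lra.
      * eapply ldge_le; [exact HN | auto].
  - rewrite Rminus_0_r. apply Rnot_lt_le. intros Hlt.
    destruct (HU b (U b - (V + eps))) as [N HN]; [lra |]. specialize (HN N (le_n N)).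
    specialize (HTb N). unfold R_dist in HN. apply Rabs_lt_between in HN. lra.
Qed.

(** * Null sets *)

Definition chi (E : R -> Prop) (x : R) : R := if excluded_middle_informative (E x) then 1 else 0.

Lemma chi_in (E : R -> Prop) (x : R) : E x -> chi E x = 1.
Proof. intros H. unfold chi. destruct (excluded_middle_informative (E x)); tauto. Qed.

Lemma chi_out (E : R -> Prop) (x : R) : ~ E x -> chi E x = 0.
Proof. intros H. unfold chi. destruct (excluded_middle_informative (E x)); tauto. Qed.

Lemma chi_nonneg (E : R -> Prop) (x : R) : 0 <= chi E x.
Proof. unfold chi. destruct (excluded_middle_informative (E x)); lra. Qed.

Lemma sum_nonneg_ge_term (u : nat -> R) (N : nat) : (forall k, 0 <= u k) -> u N <= sum_f_R0 u N.
Proof.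
  intros Hu. destruct N as [| N]; simpl; [lra |].
  assert (0 <= sum_f_R0 u N) by (apply cond_pos_sum; assumption). lra.
Qed.

(** [clamp c d] has slope 1 on both sides of every point of the open interval; elsewhere its
    monotonicity suffices. Its total increment is at most [d - c]. *)
Lemma maj_open_interval (a b c d : R) : c <= d -> maj (chi (fun x => c < x < d)) (clamp c d) a b.
Proof.
  intros Hcd. assert (Hc := continuity_clamp c d Hcd). split; [assumption |].
  intros x _. unfold chi. destruct (excluded_middle_informative _) as [Hx | Hx].
  - split; intros _.
    + apply (ldge_local (fun t => t) _ 1 1 (d - x)); try lra; try apply ldge_id;
        [apply derivable_continuous; reg | apply continuity_incr_r; assumption |].
      intros t Ht. rewrite !clamp_id by lra. lra.
    + apply (ldge_local (fun t => t) _ 1 1 (x - c)); try lra; try apply ldge_id;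
        [apply derivable_continuous; reg | apply continuity_incr_l; assumption |].
      intros t Ht. rewrite !clamp_id by lra. lra.
  - split; intros _; apply (ldge_nonneg _ 1 1); try lra;
      try (apply continuity_incr_r; assumption); try (apply continuity_incr_l; assumption);
      intros t Ht.
    + pose proof (clamp_mono c d x (x + t) Hcd). lra.
    + pose proof (clamp_mono c d (x - t) x Hcd). lra.
Qed.

Definition negligible (E : R -> Prop) (a b : R) : Prop := upper_le (chi E) a b 0.

Lemma null_set_negligible (E : R -> Prop) (a b : R) : a <= b -> null_set E -> negligible E a b.
Proof.
  intros Hab HE. apply upper_limit. intros eps He. rewrite Rplus_0_l.
  destruct (HE eps He) as [c [d [Hcd [Hcov Hsum]]]].
  apply (upper_series (fun i => chi (fun x => c i < x < d i)) (fun i => d i - c i)); try assumption.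
  - intros; apply chi_nonneg.
  - intros i r Hr. exists (clamp (c i) (d i)). split; [apply maj_open_interval, Hcd |].
    destruct (clamp_in (c i) (d i) a (Hcd i)), (clamp_in (c i) (d i) b (Hcd i)). lra.
  - intros x _ r Hr.
    destruct (excluded_middle_informative (E x)) as [Hx | Hx].
    + destruct (Hcov x Hx) as [i Hi]. exists i. rewrite chi_in by assumption.
      pose proof (sum_nonneg_ge_term (fun k => chi (fun x => c k < x < d k) x) i
        (fun k => chi_nonneg _ x)) as H. simpl in H. rewrite (chi_in _ _ Hi) in H. lra.
    + exists 0%nat. rewrite (chi_out E) by assumption. simpl.
      pose proof (chi_nonneg (fun x => c 0%nat < x < d 0%nat) x). lra.
Qed.

Lemma sum_const_zero (N : nat) : sum_f_R0 (fun _ => 0) N <= 0.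
Proof. rewrite sum_cte. lra. Qed.

Lemma negligible_union (E : nat -> R -> Prop) (a b : R) :
  a <= b -> (forall n, negligible (E n) a b) -> negligible (fun x => exists n, E n x) a b.
Proof.
  intros Hab HE. apply (upper_series (fun n => chi (E n)) (fun _ => 0)); try assumption.
  - intros; apply chi_nonneg.
  - apply sum_const_zero.
  - intros x _ r Hr. destruct (classic (exists n, E n x)) as [Hx | Hx].
    + rewrite chi_in by assumption. destruct Hx as [n Hn]. exists n.
      pose proof (sum_nonneg_ge_term (fun k => chi (E k) x) n
        (fun k => chi_nonneg _ x)) as H. simpl in H. rewrite (chi_in _ _ Hn) in H. lra.
    + exists 0%nat. rewrite chi_out by assumption. simpl. pose proof (chi_nonneg (E 0%nat) x). lra.
Qed.

(** The series whose terms are all [chi E] diverges on [E], so it exceeds any real value of [f]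
    there, yet its upper integral is still at most 0. *)
Lemma upper_le_negligible (E : R -> Prop) (f : R -> R) (a b : R) :
  a <= b -> negligible E a b -> (forall x, a <= x <= b -> ~ E x -> f x <= 0) -> upper_le f a b 0.
Proof.
  intros Hab HE Hf. apply (upper_series (fun _ => chi E) (fun _ => 0)); try assumption.
  - intros; apply chi_nonneg.
  - intros _. exact HE.
  - apply sum_const_zero.
  - intros x Hx r Hr. destruct (classic (E x)) as [HEx | HEx].
    + destruct (INR_archimed 1 (f x)) as [N HN]; [lra |]. exists N.
      rewrite sum_cte, chi_in, S_INR by assumption. lra.
    + exists 0%nat. simpl. specialize (Hf x Hx HEx). pose proof (chi_nonneg E x). lra.
Qed.

Lemma integ_ae (E : R -> Prop) (f g : R -> R) (a b v : R) :
  a <= b -> negligible E a b -> (forall x, a <= x <= b -> ~ E x -> f x = g x) ->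
  integ f a b v -> integ g a b v.
Proof.
  intros Hab HE Hfg [H1 H2].
  split; [apply (upper_mono _ (fun x => f x + (g x - f x)) _ _ (v + 0))
         | apply (upper_mono _ (fun x => - f x + (f x - g x)) _ _ (- v + 0))];
    try (intros; lra); apply upper_plus; try assumption;
    apply (upper_le_negligible E); try assumption; intros x Hx HEx;
    rewrite (Hfg x Hx HEx); lra.
Qed.

Lemma is_lim_seq_eps (u : nat -> R) (l : R) :
  is_lim_seq u l <-> forall eps, 0 < eps -> exists N, forall n, (N <= n)%nat -> Rabs (u n - l) < eps.
Proof. rewrite is_lim_seq_Reals. reflexivity. Qed.

(** The upper bound comes from [upper_series] applied to the nonnegative differences of consecutive
    functions, which telescope to [g - gs 0]; the lower bound comes from [gs N <= g]. *)
Lemma monotone_convergence (gs : nat -> R -> R) (w : nat -> R) (g : R -> R) (a b C : R) :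
  a <= b -> (forall n, integ (gs n) a b (w n)) ->
  (forall n x, a <= x <= b -> gs n x <= gs (S n) x) ->
  (forall n, w n <= C) ->
  (forall x, a <= x <= b -> is_lim_seq (fun n => gs n x) (g x)) ->
  exists l : R, is_lim_seq w l /\ integ g a b l.
Proof.
  intros Hab Hw Hinc HC Hlim.
  assert (Hwi : Un_growing w) by (intros n; apply (integ_le (gs n) (gs (S n)) a b); auto).
  destruct (growing_cv w Hwi) as [l Hl].
  { exists C. intros r [n ->]. apply HC. }
  assert (Hwl : forall n, w n <= l) by (intros n; apply growing_ineq; assumption).
  assert (Hgl : forall n x, a <= x <= b -> gs n x <= g x).
  { intros n x Hx. apply (growing_ineq (fun n => gs n x)).
    - intros m. apply Hinc, Hx.
    - apply is_lim_seq_Reals, Hlim, Hx. }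
  exists l. split; [apply is_lim_seq_Reals, Hl |]. split.
  - apply (upper_mono _ (fun x => gs 0%nat x + (g x - gs 0%nat x)) _ _ (w 0%nat + (l - w 0%nat)));
      [intros; lra | lra |].
    apply upper_plus; [apply Hw |].
    assert (Htel : forall (u : nat -> R) N, sum_f_R0 (fun n => u (S n) - u n) N = u (S N) - u 0%nat).
    { intros u N. induction N as [| N IH]; simpl; [| rewrite IH]; lra. }
    apply (upper_series (fun n x => gs (S n) x - gs n x) (fun n => w (S n) - w n)); try assumption.
    + intros n x Hx. specialize (Hinc n x Hx). lra.
    + intros n. apply (integ_minus (gs (S n)) (gs n)); apply Hw.
    + intros N. rewrite Htel. specialize (Hwl (S N)). lra.
    + intros x Hx r Hr. specialize (Hlim x Hx). rewrite is_lim_seq_eps in Hlim.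
      destruct (Hlim r Hr) as [N HN]. exists N. specialize (HN (S N) ltac:(lia)).
      rewrite (Htel (fun n => gs n x)). apply Rabs_lt_between in HN. lra.
  - apply upper_limit. intros r Hr. destruct (Hl r Hr) as [N HN]. specialize (HN N (le_n N)).
    unfold R_dist in HN. apply Rabs_lt_between in HN.
    apply (upper_mono _ (fun x => - gs N x) _ _ (- w N)); [| lra | apply Hw].
    intros x Hx. specialize (Hgl N x Hx). lra.
Qed.

Lemma monotone_convergence_decr (gs : nat -> R -> R) (w : nat -> R) (g : R -> R) (a b C : R) :
  a <= b -> (forall n, integ (gs n) a b (w n)) ->
  (forall n x, a <= x <= b -> gs (S n) x <= gs n x) ->
  (forall n, C <= w n) ->
  (forall x, a <= x <= b -> is_lim_seq (fun n => gs n x) (g x)) ->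
  exists l : R, is_lim_seq w l /\ integ g a b l.
Proof.
  intros Hab Hw Hdec HC Hlim.
  destruct (monotone_convergence (fun n x => - gs n x) (fun n => - w n) (fun x => - g x) a b (- C))
    as [l [Hl Hi]]; try assumption.
  - intros n. apply integ_opp, Hw.
  - intros n x Hx. specialize (Hdec n x Hx). lra.
  - intros n. specialize (HC n). lra.
  - intros x Hx. apply (is_lim_seq_opp _ (g x)), Hlim, Hx.
  - exists (- l). split.
    + apply is_lim_seq_ext with (fun n => - - w n); [intros; lra |].
      apply (is_lim_seq_opp _ l), Hl.
    + apply (integ_ext (fun x => - - g x)); [intros; lra | apply integ_opp; assumption].
Qed.

(** * Lattice operations, Fatou, dominated convergence *)

Lemma integ_nonneg (f : R -> R) (a b v : R) :
  a <= b -> (forall x, a <= x <= b -> 0 <= f x) -> integ f a b v -> 0 <= v.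
Proof. intros Hab Hf Hv. apply (integ_le (fun _ => 0) f a b); try assumption. apply integ_zero. Qed.

(** Quantifying over all subintervals lets a primitive be restricted, and reduces each integral to
    an increment of one function. *)
Definition is_primitive (f F : R -> R) (a b : R) : Prop :=
  forall x y, a <= x <= y -> y <= b -> integ f x y (F y - F x).

Lemma primitive_exists (f : R -> R) (a b v : R) :
  a <= b -> integ f a b v -> exists F, is_primitive f F a b /\ F b - F a = v.
Proof.
  intros Hab Hv.
  (* Clamping makes the existence hold for every real [x], as the choice of [F] requires. *)
  assert (Hch : forall x, exists u, integ f a (clamp a b x) u).
  { intros x. destruct (integ_split f a b (clamp a b x) v (clamp_in a b x Hab) Hv) as [u [Hu _]].
    exists u. assumption. }
  pose (F x := proj1_sig (constructive_indefinite_description _ (Hch x))).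
  assert (HF : forall x, a <= x <= b -> integ f a x (F x)).
  { intros x Hx. pose proof (proj2_sig (constructive_indefinite_description _ (Hch x))) as H.
    fold (F x) in H. simpl in H. rewrite clamp_id in H by assumption. exact H. }
  assert (Hp : is_primitive f F a b).
  { intros x y Hx Hy. destruct (integ_split f a y x (F y)) as [u [Hu1 Hu2]]; [assumption | apply HF; lra |].
    replace (F x) with u; [assumption |]. apply (integ_unique f a x); [lra | assumption | apply HF; lra]. }
  exists F. split; [assumption |]. apply (integ_unique f a b); [assumption | apply Hp; lra | assumption].
Qed.

Lemma primitive_incr (f F : R -> R) (a b x y : R) :
  is_primitive f F a b -> (forall z, a <= z <= b -> 0 <= f z) -> a <= x <= y -> y <= b -> F x <= F y.
Proof.
  intros HF Hf Hx Hy. assert (0 <= F y - F x); [| lra].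
  apply (integ_nonneg f x y); [lra | intros; apply Hf; lra | apply HF; assumption].
Qed.

(* The values of the sums of [phi] over the partitions of [[a, y]]. *)
Inductive psum (phi : R -> R -> R) (a : R) : R -> R -> Prop :=
| psum_one y : a <= y -> psum phi a y (phi a y)
| psum_snoc y z v : psum phi a y v -> y <= z -> psum phi a z (v + phi y z).

(** A subadditive function of intervals: refining a partition can only increase the sums, hence the
    supremum over partitions below. *)
Definition incmax (U W : R -> R) (x y : R) : R := Rmax (U y - U x) (W y - W x).

Lemma psum_le (phi : R -> R -> R) (a y v : R) : psum phi a y v -> a <= y.
Proof. induction 1; lra. Qed.

(** The same partition serves for [psi], and the excesses [D t - D s] telescope. *)
Lemma psum_additive_bound (phi psi : R -> R -> R) (D : R -> R) (a b y v : R) :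
  (forall s t, a <= s <= t -> t <= b -> phi s t <= psi s t + (D t - D s)) ->
  psum phi a y v -> y <= b -> exists v', psum psi a y v' /\ v <= v' + (D y - D a).
Proof.
  intros Hphi. induction 1 as [y Hy | y z v Hv IH Hz]; intros Hb.
  - exists (psi a y). split; [constructor; assumption | apply Hphi; lra].
  - destruct IH as [v' [Hv' Hle]]; [lra |]. exists (v' + psi y z).
    split; [constructor; assumption |]. apply psum_le in Hv.
    assert (phi y z <= psi y z + (D z - D y)) by (apply Hphi; lra). lra.
Qed.

Lemma incmax_bound (U W : R -> R) (a b s t : R) :
  (forall x y, a <= x <= y -> y <= b -> U x <= U y) ->
  (forall x y, a <= x <= y -> y <= b -> W x <= W y) ->
  a <= s <= t -> t <= b -> incmax U W s t <= (U t + W t) - (U s + W s).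
Proof.
  intros HU HW Hs Ht. specialize (HU s t Hs Ht). specialize (HW s t Hs Ht).
  unfold incmax. apply Rmax_lub; lra.
Qed.

Lemma psum_bound (U W : R -> R) (a b y v : R) :
  (forall x y, a <= x <= y -> y <= b -> U x <= U y) ->
  (forall x y, a <= x <= y -> y <= b -> W x <= W y) ->
  psum (incmax U W) a y v -> y <= b -> v <= (U y + W y) - (U a + W a).
Proof.
  intros HU HW. induction 1 as [y Hy | y z v Hv IH Hz]; intros Hb.
  - apply (incmax_bound U W a b); try assumption; lra.
  - specialize (IH ltac:(lra)). apply psum_le in Hv.
    assert (incmax U W y z <= (U z + W z) - (U y + W y)); [| lra].
    apply (incmax_bound U W a b); try assumption; lra.
Qed.

(** The partition is cut at [x]; the part removed contributes at most the increment of [U + W] over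
    [[x, y]]. This is the source of the continuity of the supremum. *)
Lemma psum_truncate (U W : R -> R) (a b x y v : R) :
  (forall x y, a <= x <= y -> y <= b -> U x <= U y) ->
  (forall x y, a <= x <= y -> y <= b -> W x <= W y) ->
  psum (incmax U W) a y v -> a <= x <= y -> y <= b ->
  exists v', psum (incmax U W) a x v' /\ v <= v' + ((U y + W y) - (U x + W x)).
Proof.
  intros HU HW Hv.
  assert (Hsub : forall s t, a <= s <= x -> x <= t <= b ->
            incmax U W s t <= incmax U W s x + ((U t + W t) - (U x + W x))).
  { intros s t Hs Ht. specialize (HU x t ltac:(lra) ltac:(lra)). specialize (HW x t ltac:(lra) ltac:(lra)).
    unfold incmax. pose proof (Rmax_l (U x - U s) (W x - W s)). pose proof (Rmax_r (U x - U s) (W x - W s)).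
    apply Rmax_lub; lra. }
  induction Hv as [y Hy | y z v Hv IH Hz]; intros Hx Hb.
  - exists (incmax U W a x). split; [constructor; lra | apply Hsub; lra].
  - assert (Hay := psum_le _ _ _ _ Hv). destruct (Rle_dec x y) as [Hxy | Hxy].
    + destruct IH as [v' [Hv' Hle]]; [lra | lra |]. exists v'. split; [assumption |].
      assert (incmax U W y z <= (U z + W z) - (U y + W y)); [| lra].
      apply (incmax_bound U W a b); try assumption; lra.
    + exists (v + incmax U W y x). split; [constructor; [assumption | lra] |].
      specialize (Hsub y z ltac:(lra) ltac:(lra)). lra.
Qed.

(** [M x] is the supremum of the partition sums over [[a, x]]. Appending an interval to a partition
    shows that the increments of [M] dominate those of [U] and of [W], so [M] is a major function of
    [f] and of [g] at once, and pointwise one of these is the maximum. *)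
Lemma maj_max (f g U W : R -> R) (a b : R) :
  a <= b ->
  (forall x, a <= x <= b -> 0 <= f x) -> (forall x, a <= x <= b -> 0 <= g x) ->
  maj f U a b -> maj g W a b ->
  exists M, maj (fun x => Rmax (f x) (g x)) M a b /\
    forall c, (forall v, psum (incmax U W) a b v -> v <= c) -> M b - M a <= c.
Proof.
  intros Hab Hf Hg HU HW.
  assert (HUi : forall x y, a <= x <= y -> y <= b -> U x <= U y)
    by (intros; apply (maj_increasing f U a b); assumption).
  assert (HWi : forall x y, a <= x <= y -> y <= b -> W x <= W y)
    by (intros; apply (maj_increasing g W a b); assumption).
  assert (Hs : forall x, { m | is_lub (psum (incmax U W) a (clamp a b x)) m }).
  { intros x. destruct (clamp_in a b x Hab). apply completeness.
    - exists ((U (clamp a b x) + W (clamp a b x)) - (U a + W a)). intros v Hv.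
      apply (psum_bound U W a b); assumption.
    - exists (incmax U W a (clamp a b x)). constructor. lra. }
  pose (M x := proj1_sig (Hs x)).
  assert (HM : forall x, is_lub (psum (incmax U W) a (clamp a b x)) (M x))
    by (intros x; exact (proj2_sig (Hs x))).
  clearbody M. clear Hs.
  assert (Hlow : forall x y, a <= x <= y -> y <= b -> incmax U W x y <= M y - M x).
  { intros x y Hx Hy. destruct (HM x) as [_ Hx2]. destruct (HM y) as [Hy1 _].
    rewrite clamp_id in Hx2, Hy1 by lra.
    assert (M x <= M y - incmax U W x y); [| lra].
    apply Hx2. intros v Hv. assert (v + incmax U W x y <= M y); [| lra].
    apply Hy1. constructor; [assumption | lra]. }
  assert (Hhigh : forall x y, x <= y ->
    M y - M x <= (U (clamp a b y) + W (clamp a b y)) - (U (clamp a b x) + W (clamp a b x))).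
  { intros x y Hxy. destruct (HM x) as [Hx1 _]. destruct (HM y) as [_ Hy2].
    assert (Hc := clamp_mono a b x y Hab Hxy). destruct (clamp_in a b x Hab), (clamp_in a b y Hab).
    assert (M y <= M x + ((U (clamp a b y) + W (clamp a b y)) - (U (clamp a b x) + W (clamp a b x)))); [| lra].
    apply Hy2. intros v Hv.
    destruct (psum_truncate U W a b (clamp a b x) (clamp a b y) v) as [v' [Hv' Hle]]; try assumption; [lra |].
    specialize (Hx1 v' Hv'). lra. }
  assert (HMcl : forall x, M x = M (clamp a b x)).
  { intros x. apply (is_lub_u (psum (incmax U W) a (clamp a b x))); [apply HM |].
    specialize (HM (clamp a b x)). rewrite (clamp_id a b (clamp a b x)) in HM by (apply clamp_in; assumption).
    assumption. }
  assert (HMc : continuity M).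
  { apply continuity_modulus. intros eps He.
    exists (fun x => U (clamp a b x) + W (clamp a b x)). split.
    - apply (continuity_plus (fun x => U (clamp a b x)));
        apply continuity_comp_clamp; try assumption; [apply HU | apply HW].
    - assert (Hw : forall x y, x <= y -> Rabs (M y - M x)
        <= Rabs ((U (clamp a b y) + W (clamp a b y)) - (U (clamp a b x) + W (clamp a b x))) + eps).
      { intros x y Hxy. specialize (Hhigh x y Hxy).
        assert (Hc := clamp_mono a b x y Hab Hxy). destruct (clamp_in a b x Hab), (clamp_in a b y Hab).
        assert (Hm : 0 <= M y - M x).
        { rewrite (HMcl x), (HMcl y). eapply Rle_trans; [| apply Hlow; lra].
          unfold incmax. eapply Rle_trans; [| apply Rmax_l].
          specialize (HUi (clamp a b x) (clamp a b y) ltac:(lra) ltac:(lra)). lra. }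
        rewrite !Rabs_pos_eq by lra. lra. }
      intros x y. destruct (Rle_dec x y) as [Hxy | Hxy].
      + rewrite (Rabs_minus_sym (M x)), (Rabs_minus_sym (U (clamp a b x) + W (clamp a b x))). apply Hw; assumption.
      + apply Hw. lra. }
  exists M. split.
  - assert (HMf : maj f M a b).
    { apply (maj_incr_le f f U M); try assumption; [intros; lra |].
      intros x y Hx Hy. eapply Rle_trans; [| apply Hlow; assumption]. apply Rmax_l. }
    assert (HMg : maj g M a b).
    { apply (maj_incr_le g g W M); try assumption; [intros; lra |].
      intros x y Hx Hy. eapply Rle_trans; [| apply Hlow; assumption]. apply Rmax_r. }
    destruct HMf as [_ HMf], HMg as [_ HMg]. split; [assumption |].
    intros x Hx. unfold Rmax. destruct (Rle_dec (f x) (g x)); auto.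
  (* A partition of the degenerate interval at [a] has only degenerate pieces, whose sums vanish. *)
  - intros c Hc. assert (HMa : M a = 0).
    { destruct (HM a) as [H1 H2]. rewrite clamp_id in H1, H2 by lra. apply Rle_antisym.
      - apply H2. intros v Hv. apply (psum_bound U W a b) in Hv; try assumption. lra.
      - apply H1. replace 0 with (incmax U W a a); [constructor; lra |].
        unfold incmax. rewrite !Rminus_diag. apply Rmax_left; lra. }
    rewrite HMa, Rminus_0_r. apply (HM b). rewrite clamp_id by lra. exact Hc.
Qed.

(** From above, [maj_max] is applied to nearly optimal [U] and [W]: on any partition, replacing them
    by [F] and [G] costs at most [eps] in total. From below, on each partition interval the maximum
    is compared with whichever of [f] and [g] has the larger integral there. *)
Lemma integ_max_lub (f g F G : R -> R) (a b : R) :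
  a <= b ->
  (forall x, a <= x <= b -> 0 <= f x) -> (forall x, a <= x <= b -> 0 <= g x) ->
  is_primitive f F a b -> is_primitive g G a b ->
  exists m, is_lub (psum (incmax F G) a b) m /\ integ (fun x => Rmax (f x) (g x)) a b m.
Proof.
  intros Hab Hf Hg HF HG.
  assert (HFi : forall x y, a <= x <= y -> y <= b -> F x <= F y)
    by (intros; apply (primitive_incr f F a b); assumption).
  assert (HGi : forall x y, a <= x <= y -> y <= b -> G x <= G y)
    by (intros; apply (primitive_incr g G a b); assumption).
  destruct (completeness (psum (incmax F G) a b)) as [m [Hm1 Hm2]].
  { exists ((F b + G b) - (F a + G a)). intros v Hv. apply (psum_bound F G a b); try assumption. lra. }
  { exists (incmax F G a b). constructor. assumption. }
  exists m. split; [split; assumption |]. split.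
  - intros eps He.
    destruct (proj1 (HF a b ltac:(lra) ltac:(lra)) (eps / 2)) as [U [HU Hu]]; [lra |].
    destruct (proj1 (HG a b ltac:(lra) ltac:(lra)) (eps / 2)) as [W [HW Hw]]; [lra |].
    destruct (maj_max f g U W a b Hab Hf Hg HU HW) as [M [HM HMb]].
    exists M. split; [assumption |]. apply HMb. intros v Hv.
    (* A major function grows at least as fast as the primitive on every subinterval, so the error
       [(U - F) + (W - G)] is nondecreasing. *)
    assert (Hcmp : forall h H V s t, is_primitive h H a b -> maj h V a b -> a <= s <= t -> t <= b ->
               H t - H s <= V t - V s).
    { intros h H V s t HH HV Hst Htb. destruct (HH s t Hst Htb) as [_ Hop].
      assert (0 <= (V t - V s) + - (H t - H s)); [| lra].
      apply (upper_opp h s t); [lra | | assumption].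
      intros r Hr. exists V. split; [apply maj_restrict with a b; try assumption; lra | lra]. }
    destruct (psum_additive_bound (incmax U W) (incmax F G) (fun x => (U x - F x) + (W x - G x)) a b b v)
      as [v' [Hv' Hle]]; try assumption; [| lra |].
    + intros s t Hs Ht. assert (H1 := Hcmp f F U s t HF HU Hs Ht).
      assert (H2 := Hcmp g G W s t HG HW Hs Ht). unfold incmax.
      pose proof (Rmax_l (F t - F s) (G t - G s)). pose proof (Rmax_r (F t - F s) (G t - G s)).
      apply Rmax_lub; lra.
    + specialize (Hm1 v' Hv'). lra.
  - assert (Hps : forall y v, psum (incmax F G) a y v -> y <= b ->
              upper_le (fun x => - Rmax (f x) (g x)) a y (- v)).
    { assert (Hpiece : forall s t, a <= s <= t -> t <= b ->
                upper_le (fun x => - Rmax (f x) (g x)) s t (- incmax F G s t)).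
      { intros s t Hs Ht. unfold incmax. apply Rmax_case.
        - apply (upper_mono _ (fun x => - f x) _ _ (- (F t - F s))); [| lra | apply HF; assumption].
          intros x _. pose proof (Rmax_l (f x) (g x)). lra.
        - apply (upper_mono _ (fun x => - g x) _ _ (- (G t - G s))); [| lra | apply HG; assumption].
          intros x _. pose proof (Rmax_r (f x) (g x)). lra. }
      induction 1 as [y Hy | y z v Hv IH Hz]; intros Hb; [apply Hpiece; lra |].
      assert (Hay := psum_le _ _ _ _ Hv). rewrite Ropp_plus_distr.
      apply upper_glue with y; [lra | apply IH; lra | apply Hpiece; lra]. }
    apply upper_limit. intros eps He.
    assert (Hex : exists v, psum (incmax F G) a b v /\ m - eps < v).
    { apply NNPP. intros Hn. apply (Rlt_irrefl m). apply Rle_lt_trans with (m - eps); [| lra].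
      apply Hm2. intros v Hv. apply Rnot_lt_le. intros Hlt. apply Hn. exists v. split; assumption. }
    destruct Hex as [v [Hv Hlt]].
    apply (upper_mono _ (fun x => - Rmax (f x) (g x)) _ _ (- v)); [intros; lra | lra |].
    apply Hps; [assumption | lra].
Qed.

Lemma integ_max (f g : R -> R) (a b v w : R) :
  a <= b ->
  (forall x, a <= x <= b -> 0 <= f x) -> (forall x, a <= x <= b -> 0 <= g x) ->
  integ f a b v -> integ g a b w -> exists m, integ (fun x => Rmax (f x) (g x)) a b m.
Proof.
  intros Hab Hf Hg Hv Hw.
  destruct (primitive_exists f a b v Hab Hv) as [F [HF _]].
  destruct (primitive_exists g a b w Hab Hw) as [G [HG _]].
  destruct (integ_max_lub f g F G a b) as [m [_ Hm]]; try assumption. exists m. assumption.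
Qed.

Lemma Rmin_plus_minus_Rmax (x y : R) : Rmin x y = x + y - Rmax x y.
Proof. unfold Rmin, Rmax. destruct (Rle_dec x y); lra. Qed.

Lemma integ_min (f g : R -> R) (a b v w : R) :
  a <= b ->
  (forall x, a <= x <= b -> 0 <= f x) -> (forall x, a <= x <= b -> 0 <= g x) ->
  integ f a b v -> integ g a b w -> exists m, integ (fun x => Rmin (f x) (g x)) a b m.
Proof.
  intros Hab Hf Hg Hv Hw. destruct (integ_max f g a b v w) as [m Hm]; try assumption.
  exists (v + w - m). apply (integ_ext (fun x => f x + g x - Rmax (f x) (g x))).
  - intros x _. symmetry. apply Rmin_plus_minus_Rmax.
  - apply (integ_minus (fun x => f x + g x)); [apply integ_plus |]; assumption.
Qed.

(** * Fatou's lemma and dominated convergence *)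

Fixpoint run_min (u : nat -> R) (n j : nat) : R :=
  match j with
  | O => u n
  | S j => Rmin (run_min u n j) (u (n + S j)%nat)
  end.

Lemma run_min_le (u : nat -> R) (n j k : nat) : (n <= k <= n + j)%nat -> run_min u n j <= u k.
Proof.
  revert k. induction j as [| j IH]; intros k Hk; simpl.
  - replace k with n by lia. lra.
  - destruct (Nat.eq_dec k (n + S j)) as [-> | Hn]; [apply Rmin_r |].
    eapply Rle_trans; [apply Rmin_l | apply IH; lia].
Qed.

Lemma run_min_glb (u : nat -> R) (n j : nat) (c : R) :
  (forall k, (n <= k <= n + j)%nat -> c <= u k) -> c <= run_min u n j.
Proof.
  induction j as [| j IH]; intros H; simpl; [apply H; lia |].
  apply Rmin_glb; [apply IH; intros; apply H; lia | apply H; lia].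
Qed.

(** The infimum [L n] of the tail is reached through two monotone limits: finite minima, integrable
    by [integ_min], decrease to [L n], and [L n] increases to [h]. *)
Lemma fatou (hs : nat -> R -> R) (v : nat -> R) (h : R -> R) (a b C : R) :
  a <= b -> (forall n, integ (hs n) a b (v n)) ->
  (forall n x, a <= x <= b -> 0 <= hs n x) ->
  (forall n, v n <= C) ->
  (forall x, a <= x <= b -> is_lim_seq (fun n => hs n x) (h x)) ->
  exists l : R, integ h a b l /\
    forall eps, 0 < eps -> exists N, forall n, (N <= n)%nat -> l - eps <= v n.
Proof.
  intros Hab Hv Hpos HC Hlim.
  pose (m n j x := run_min (fun k => hs k x) n j).
  assert (Hmpos : forall n j x, a <= x <= b -> 0 <= m n j x)
    by (intros; apply run_min_glb; intros; apply Hpos; assumption).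
  assert (Hmi : forall n j, exists w, integ (m n j) a b w).
  { intros n j. induction j as [| j [w Hw]]; [exists (v n); apply Hv |].
    apply (integ_min (m n j) (hs (n + S j)%nat) a b w (v (n + S j)%nat)); auto. }
  (* On [[a, b]] this is a genuine limit, since the minima decrease and are nonnegative. *)
  pose (L n x := real (Lim_seq (fun j => m n j x))).
  assert (HL : forall n x, a <= x <= b -> is_lim_seq (fun j => m n j x) (L n x)).
  { intros n x Hx. apply Lim_seq_correct'. apply ex_finite_lim_seq_decr with 0.
    - intros j. apply Rmin_l.
    - intros j. apply Hmpos; assumption. }
  assert (HLge : forall n x c, a <= x <= b -> (forall k, (n <= k)%nat -> c <= hs k x) -> c <= L n x).
  { intros n x c Hx Hc. apply (Un_cv_ge_eventually (fun j => m n j x) _ _ 0%nat).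
    - apply is_lim_seq_Reals, HL, Hx.
    - intros j _. apply run_min_glb. intros k Hk. apply Hc. lia. }
  assert (HLm : forall n x j, a <= x <= b -> L n x <= m n j x).
  { intros n x j Hx. apply (decreasing_ineq (fun j => m n j x)).
    - intros i. apply Rmin_l.
    - apply is_lim_seq_Reals, HL, Hx. }
  assert (HLle : forall n k x, a <= x <= b -> (n <= k)%nat -> L n x <= hs k x).
  { intros n k x Hx Hk. eapply Rle_trans; [apply (HLm n x (k - n)%nat Hx) |].
    apply (run_min_le (fun k => hs k x)). lia. }
  assert (HLi : forall n, exists l, integ (L n) a b l).
  { intros n.
    pose (w j := proj1_sig (constructive_indefinite_description _ (Hmi n j))).
    assert (Hw : forall j, integ (m n j) a b (w j))
      by (intros j; exact (proj2_sig (constructive_indefinite_description _ (Hmi n j)))).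
    destruct (monotone_convergence_decr (m n) w (L n) a b 0) as [l [_ Hl]]; try assumption.
    - intros j x _. apply Rmin_l.
    - intros j. apply (integ_nonneg (m n j) a b); auto.
    - intros x Hx. apply HL; assumption.
    - exists l. assumption. }
  pose (l n := proj1_sig (constructive_indefinite_description _ (HLi n))).
  assert (Hl : forall n, integ (L n) a b (l n))
    by (intros n; exact (proj2_sig (constructive_indefinite_description _ (HLi n)))).
  clearbody l.
  assert (Hlv : forall n, l n <= v n)
    by (intros n; apply (integ_le (L n) (hs n) a b); auto).
  destruct (monotone_convergence L l h a b C) as [r [Hr Hi]]; try assumption.
  - intros n x Hx. apply HLge; [assumption |]. intros k Hk. apply HLle; [assumption | lia].
  - intros n. specialize (Hlv n). specialize (HC n). lra.
  - intros x Hx. apply is_lim_seq_eps. intros eps He. specialize (Hlim x Hx).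
    rewrite is_lim_seq_eps in Hlim. destruct (Hlim (eps / 2)) as [N HN]; [lra |].
    exists N. intros n Hn.
    assert (h x - eps / 2 <= L n x).
    { apply HLge; [assumption |]. intros k Hk. specialize (HN k ltac:(lia)).
      apply Rabs_lt_between in HN. lra. }
    specialize (HN n Hn). specialize (HLle n n x Hx (le_n n)).
    apply Rabs_lt_between in HN. apply Rabs_lt_between. lra.
  - exists r. split; [assumption |]. intros eps He. rewrite is_lim_seq_eps in Hr.
    destruct (Hr eps He) as [N HN]. exists N. intros n Hn. specialize (HN n Hn). specialize (Hlv n).
    apply Rabs_lt_between in HN. lra.
Qed.

(** Fatou's lemma for [hs] and for [phi - hs] bounds [v] from both sides. *)
Lemma dominated_convergence (hs : nat -> R -> R) (v : nat -> R) (h phi : R -> R) (a b p : R) :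
  a <= b -> (forall n, integ (hs n) a b (v n)) -> integ phi a b p ->
  (forall n x, a <= x <= b -> 0 <= hs n x <= phi x) ->
  (forall x, a <= x <= b -> is_lim_seq (fun n => hs n x) (h x)) ->
  exists l : R, integ h a b l /\ is_lim_seq v l.
Proof.
  intros Hab Hv Hp Hbd Hlim.
  destruct (fatou hs v h a b p) as [l [Hl Hl']]; try assumption.
  { intros n x Hx. apply Hbd; assumption. }
  { intros n. apply (integ_le (hs n) phi a b); try apply Hv; try assumption. intros x Hx. apply Hbd; assumption. }
  destruct (fatou (fun n x => phi x - hs n x) (fun n => p - v n) (fun x => phi x - h x) a b p)
    as [r [Hr Hr']]; try assumption.
  { intros n. apply integ_minus; auto. }
  { intros n x Hx. specialize (Hbd n x Hx). lra. }
  { intros n. assert (0 <= v n); [| lra]. apply (integ_nonneg (hs n) a b); try apply Hv; try assumption.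
    intros x Hx. apply Hbd; assumption. }
  { intros x Hx. apply is_lim_seq_minus'; [apply is_lim_seq_const | apply Hlim; assumption]. }
  assert (r = p - l) as -> by
    (apply (integ_unique (fun x => phi x - h x) a b); [assumption | assumption | apply integ_minus; assumption]).
  exists l. split; [assumption |]. apply is_lim_seq_eps. intros eps He.
  destruct (Hl' (eps / 2)) as [N HN]; [lra |]. destruct (Hr' (eps / 2)) as [N' HN']; [lra |].
  exists (max N N'). intros n Hn. specialize (HN n ltac:(lia)). specialize (HN' n ltac:(lia)).
  apply Rabs_lt_between. lra.
Qed.

Lemma integ_truncate (q : R -> R) (a b v K : R) :
  a <= b -> 0 < K -> (forall x, a <= x <= b -> 0 <= q x) -> integ q a b v ->
  exists w, integ (fun x => Rmin (q x) K) a b w.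
Proof.
  intros Hab HK Hq Hv. apply (integ_min q (fun _ => K) a b v (K * (b - a))); try assumption.
  - intros; lra.
  - apply integ_const; assumption.
Qed.

Lemma truncation_approx (q : R -> R) (a b v eps : R) :
  a <= b -> (forall x, a <= x <= b -> 0 <= q x) -> integ q a b v -> 0 < eps ->
  exists K w, 0 < K /\ integ (fun x => Rmin (q x) K) a b w /\ v - eps < w.
Proof.
  intros Hab Hq Hv He.
  assert (HK : forall n, 0 < INR (S n)) by (intros; apply lt_0_INR; lia).
  assert (Hch := fun n => integ_truncate q a b v (INR (S n)) Hab (HK n) Hq Hv).
  pose (w n := proj1_sig (constructive_indefinite_description _ (Hch n))).
  assert (Hw : forall n, integ (fun x => Rmin (q x) (INR (S n))) a b (w n))
    by (intros n; exact (proj2_sig (constructive_indefinite_description _ (Hch n)))).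
  destruct (dominated_convergence (fun n x => Rmin (q x) (INR (S n))) w q q a b v) as [l [Hl Hlim]];
    try assumption.
  - intros n x Hx. split; [| apply Rmin_l]. apply Rmin_glb; [apply Hq; assumption |].
    apply Rlt_le, HK.
  - intros x Hx. apply is_lim_seq_eps. intros r Hr.
    destruct (INR_archimed 1 (q x)) as [N HN]; [lra |]. exists N. intros n Hn.
    rewrite Rmin_left.
    + rewrite Rminus_diag, Rabs_R0. assumption.
    + apply le_INR in Hn. rewrite S_INR. lra.
  - assert (l = v) as -> by (apply (integ_unique q a b); assumption).
    rewrite is_lim_seq_eps in Hlim. destruct (Hlim eps He) as [N HN].
    exists (INR (S N)), (w N). repeat split; [apply HK | apply Hw | apply Hw |].
    specialize (HN N (le_n N)). apply Rabs_lt_between in HN. lra.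
Qed.

(** * Comparison with the Laplace integral *)

Lemma Rbar_lub_spec (E : Rbar -> Prop) : Rbar_is_lub E (Rbar_lub E).
Proof. exact (proj2_sig (Rbar_ex_lub E)). Qed.

Lemma Rbar_glb_spec (E : Rbar -> Prop) : Rbar_is_glb E (Rbar_glb E).
Proof. exact (proj2_sig (Rbar_ex_glb E)). Qed.

Lemma Rbar_le_approx_l (c : R) (y : Rbar) :
  (forall eps, 0 < eps -> Rbar_le (c - eps) y) -> Rbar_le c y.
Proof.
  destruct y as [r | |]; simpl; intros H; [| exact I | apply (H 1); lra].
  apply Rnot_lt_le. intros Hlt. specialize (H ((c - r) / 2) ltac:(lra)). lra.
Qed.

Lemma Rbar_le_approx_r (c : R) (y : Rbar) :
  (forall eps, 0 < eps -> Rbar_le y (c + eps)) -> Rbar_le y c.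
Proof.
  destruct y as [r | |]; simpl; intros H; [| apply (H 1); lra | exact I].
  apply Rnot_lt_le. intros Hlt. specialize (H ((r - c) / 2) ltac:(lra)). lra.
Qed.

Lemma liminf_pinfty_ge (phi : R -> R) (c : R) :
  Rbar_le c (liminf_pinfty phi) <->
  forall eps, 0 < eps -> exists M, forall s, M <= s -> c - eps <= phi s.
Proof.
  unfold liminf_pinfty.
  set (inf M := Rbar_glb (fun z => exists s, M <= s /\ z = Finite (phi s))).
  assert (Hinf : forall M, Rbar_is_glb (fun z => exists s, M <= s /\ z = Finite (phi s)) (inf M))
    by (intros M; apply Rbar_glb_spec).
  set (E := fun y => exists M : R, y = inf M).
  assert (HE : Rbar_is_lub E (Rbar_lub E)) by apply Rbar_lub_spec.
  destruct HE as [Hub Hlub]. split.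
  - intros Hc eps He. apply NNPP. intros Hn.
    assert (Hle : Rbar_le (Rbar_lub E) (Finite (c - eps))).
    { apply Hlub. intros y [M ->]. apply Rbar_not_lt_le. intros Hlt. apply Hn.
      exists M. intros s Hs. destruct (Hinf M) as [Hlow _].
      assert (H : Rbar_le (inf M) (Finite (phi s))) by (apply Hlow; exists s; split; [assumption | reflexivity]).
      assert (H' := Rbar_lt_le_trans _ _ _ Hlt H). simpl in H'. lra. }
    assert (H := Rbar_le_trans _ _ _ Hc Hle). simpl in H. lra.
  - intros H. apply Rbar_le_approx_l. intros eps He. destruct (H eps He) as [M HM].
    apply Rbar_le_trans with (inf M); [| apply Hub; exists M; reflexivity].
    apply (Hinf M). intros z [s [Hs ->]]. simpl. apply HM; assumption.
Qed.

Lemma limsup_pinfty_le (phi : R -> R) (c : R) :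
  Rbar_le (limsup_pinfty phi) c <->
  forall eps, 0 < eps -> exists M, forall s, M <= s -> phi s <= c + eps.
Proof.
  unfold limsup_pinfty.
  set (sup M := Rbar_lub (fun z => exists s, M <= s /\ z = Finite (phi s))).
  assert (Hsup : forall M, Rbar_is_lub (fun z => exists s, M <= s /\ z = Finite (phi s)) (sup M))
    by (intros M; apply Rbar_lub_spec).
  set (E := fun y => exists M : R, y = sup M).
  assert (HE : Rbar_is_glb E (Rbar_glb E)) by apply Rbar_glb_spec.
  destruct HE as [Hlb Hglb]. split.
  - intros Hc eps He. apply NNPP. intros Hn.
    assert (Hle : Rbar_le (Finite (c + eps)) (Rbar_glb E)).
    { apply Hglb. intros y [M ->]. apply Rbar_not_lt_le. intros Hlt. apply Hn.
      exists M. intros s Hs. destruct (Hsup M) as [Hup _].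
      assert (H : Rbar_le (Finite (phi s)) (sup M)) by (apply Hup; exists s; split; [assumption | reflexivity]).
      assert (H' := Rbar_le_lt_trans _ _ _ H Hlt). simpl in H'. lra. }
    assert (H := Rbar_le_trans _ _ _ Hle Hc). simpl in H. lra.
  - intros H. apply Rbar_le_approx_r. intros eps He. destruct (H eps He) as [M HM].
    apply Rbar_le_trans with (sup M); [apply Hlb; exists M; reflexivity |].
    apply (Hsup M). intros z [s [Hs ->]]. simpl. apply HM; assumption.
Qed.

Lemma Rbar_min_ge (c x y : Rbar) : Rbar_le c (Rbar_min x y) <-> Rbar_le c x /\ Rbar_le c y.
Proof.
  unfold Rbar_min.
  destruct c, x, y; simpl; unfold Rmin; try destruct (Rle_dec _ _); split; intros; try lra; try tauto.
Qed.

Lemma lowerLD_ge (F : R -> R) (a b x c : R) :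
  Rbar_le c (lowerLD F a b x) <->
  (x < b -> Rbar_le c (liminf_pinfty (LT_right F b x))) /\
  (a < x -> Rbar_le c (liminf_pinfty (LT_left F a x))).
Proof.
  unfold lowerLD. destruct (Rlt_dec x b), (Rlt_dec a x); rewrite ?Rbar_min_ge; try tauto.
  split; [intros _; split; intros; contradiction | intros _; exact I].
Qed.

Lemma upperLD_le (F : R -> R) (a b x c : R) :
  Rbar_le (upperLD F a b x) c <->
  (x < b -> Rbar_le (limsup_pinfty (LT_right F b x)) c) /\
  (a < x -> Rbar_le (limsup_pinfty (LT_left F a x)) c).
Proof.
  unfold upperLD. destruct (Rlt_dec x b), (Rlt_dec a x); try tauto.
  - rewrite <- Rbar_opp_le, Rbar_opp_involutive, Rbar_min_ge, !Rbar_opp_le. tauto.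
  - split; [intros _; split; intros; contradiction | intros _; exact I].
Qed.

Lemma cont_on_clamp (F : R -> R) (a b : R) :
  a <= b -> cont_on F a b -> continuity (fun x => F (clamp a b x)).
Proof.
  intros Hab HF x. apply continuity_pt_filterlim.
  apply (filterlim_comp _ _ _ (clamp a b) F _
           (within (fun y => a <= y <= b) (locally (clamp a b x)))).
  - intros P HP. unfold filtermap.
    assert (Hc : filterlim (clamp a b) (locally x) (locally (clamp a b x)))
      by (apply continuity_pt_filterlim, continuity_clamp; assumption).
    specialize (Hc _ HP). unfold filtermap in Hc. revert Hc. apply filter_imp.
    intros y Hy. apply Hy, clamp_in; assumption.
  - apply HF, clamp_in; assumption.
Qed.

Lemma continuity_cont_on (F : R -> R) (a b : R) : continuity F -> cont_on F a b.
Proof.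
  intros HF x _ P HP. assert (Hc := proj1 (continuity_pt_filterlim F x) (HF x) P HP).
  exact (filter_le_within (F := locally x) (fun y => a <= y <= b) (fun y => P (F y)) Hc).
Qed.

Lemma LT_right_eq (F : R -> R) (a b x s : R) :
  a <= x < b -> LT_right F b x s = LT (fun t => F (clamp a b (x + t)) - F (clamp a b x)) (b - x) s.
Proof.
  intros Hx. transitivity (LT (fun t => F (x + t) - F x) (b - x) s); [reflexivity |].
  apply LT_ext; [lra |]. intros t Ht. rewrite !clamp_id by lra. reflexivity.
Qed.

(** [LT_left] has its minus sign outside the integral; moving it inside is an instance of linearity,
    which here goes through continuity of the clamped function. *)
Lemma LT_left_eq (F : R -> R) (a b x s : R) :
  cont_on F a b -> a < x <= b ->
  LT_left F a x s = LT (fun t => F (clamp a b x) - F (clamp a b (x - t))) (x - a) s.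
Proof.
  intros HF Hx.
  assert (Hc := cont_on_clamp F a b ltac:(lra) HF).
  transitivity (- LT (fun t => F (x - t) - F x) (x - a) s); [unfold LT_left, LT; ring |].
  rewrite (LT_ext _ (fun t => -1 * (F (clamp a b x) - F (clamp a b (x - t))))); [| lra |].
  - rewrite LT_scal by (apply (continuity_incr_l (fun x => F (clamp a b x))); assumption). ring.
  - intros t Ht. rewrite !clamp_id by lra. ring.
Qed.

Lemma major_maj (f U : R -> R) (a b : R) :
  a < b -> major f U a b -> maj f (fun x => U (clamp a b x)) a b.
Proof.
  intros Hab [HU Hm]. assert (Hc := cont_on_clamp U a b ltac:(lra) HU).
  split; [assumption |]. intros x Hx. destruct (Hm x Hx) as [Hle _].
  rewrite lowerLD_ge, !liminf_pinfty_ge in Hle. destruct Hle as [Hr Hl]. split; intros Hb.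
  - apply (ldge_local (fun t => U (clamp a b (x + t)) - U (clamp a b x)) _ (b - x) 1 1); try lra;
      try (apply (continuity_incr_r (fun x => U (clamp a b x))); assumption); [intros; lra |].
    intros eps He. destruct (Hr Hb eps He) as [M HM]. exists M. intros s Hs.
    rewrite <- LT_right_eq by lra. apply HM; assumption.
  - apply (ldge_local (fun t => U (clamp a b x) - U (clamp a b (x - t))) _ (x - a) 1 1); try lra;
      try (apply (continuity_incr_l (fun x => U (clamp a b x))); assumption); [intros; lra |].
    intros eps He. destruct (Hl Hb eps He) as [M HM]. exists M. intros s Hs.
    rewrite <- LT_left_eq by (try assumption; lra). apply HM; assumption.
Qed.

Lemma maj_major (f U : R -> R) (a b : R) : maj f U a b -> major f U a b.
Proof.
  intros [HU Hm]. assert (Hco := continuity_cont_on U a b HU). split; [assumption |]. intros x Hx.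
  assert (Hle : Rbar_le (f x) (lowerLD U a b x)).
  { rewrite lowerLD_ge, !liminf_pinfty_ge. destruct (Hm x Hx) as [Hr Hl]. split; intros Hb.
    - apply (ldge_local (fun t => U (x + t) - U x) (fun t => U (x + t) - U x) 1 (b - x) 1); try lra;
        try (apply continuity_incr_r; assumption); [intros; lra | auto].
    - intros eps He.
      assert (Hld : ldge (fun t => U x - U (x - t)) (x - a) (f x)).
      { apply (ldge_local (fun t => U x - U (x - t)) (fun t => U x - U (x - t)) 1 (x - a) 1); try lra;
          try (apply continuity_incr_l; assumption); [intros; lra | auto]. }
      destruct (Hld eps He) as [M HM]. exists M. intros s Hs. specialize (HM s Hs).
      rewrite (LT_left_eq U a b) by (try assumption; lra).
      rewrite (LT_ext _ (fun t => U x - U (x - t))); [assumption | lra |].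
      intros t Ht. rewrite !clamp_id by lra. reflexivity. }
  (* A derivate bounded below by the real number [f x] cannot be minus infinity. *)
  split; [assumption |]. intros Heq. rewrite Heq in Hle. exact Hle.
Qed.

Lemma cont_on_opp (F : R -> R) (a b : R) : cont_on F a b -> cont_on (fun x => - F x) a b.
Proof.
  intros HF x Hx. apply (filterlim_comp _ _ _ F Ropp _ (locally (F x))); [apply HF; assumption |].
  apply (filterlim_opp (V := R_NormedModule)).
Qed.

Lemma LT_right_opp (F : R -> R) (a b x s : R) :
  cont_on F a b -> a <= x < b -> LT_right (fun x => - F x) b x s = - LT_right F b x s.
Proof.
  intros HF Hx. assert (Hc := cont_on_clamp F a b ltac:(lra) HF).
  rewrite (LT_right_eq F a), (LT_right_eq (fun x => - F x) a) by lra.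
  rewrite (LT_ext _ (fun t => -1 * (F (clamp a b (x + t)) - F (clamp a b x)))) by (intros; lra).
  rewrite LT_scal by (apply (continuity_incr_r (fun x => F (clamp a b x))); assumption). ring.
Qed.

Lemma LT_left_opp (F : R -> R) (a b x s : R) :
  cont_on F a b -> a < x <= b -> LT_left (fun x => - F x) a x s = - LT_left F a x s.
Proof.
  intros HF Hx. assert (Hc := cont_on_clamp F a b ltac:(lra) HF).
  rewrite (LT_left_eq F a b), (LT_left_eq (fun x => - F x) a b)
    by (try apply cont_on_opp; try assumption; lra).
  rewrite (LT_ext _ (fun t => -1 * (F (clamp a b x) - F (clamp a b (x - t))))) by (intros; lra).
  rewrite LT_scal by (apply (continuity_incr_l (fun x => F (clamp a b x))); assumption). ring.
Qed.

Lemma minor_opp_major (f V : R -> R) (a b : R) :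
  minor f V a b <-> major (fun x => - f x) (fun x => - V x) a b.
Proof.
  assert (Hopp : forall phi psi c, (forall s, psi s = - phi s) ->
    (Rbar_le (limsup_pinfty phi) (Finite c) <-> Rbar_le (Finite (- c)) (liminf_pinfty psi))).
  { intros phi psi c Hpsi. rewrite limsup_pinfty_le, liminf_pinfty_ge.
    split; intros H eps He; destruct (H eps He) as [M HM]; exists M; intros s Hs;
      specialize (HM s Hs); rewrite Hpsi in *; lra. }
  assert (Hx : forall x, cont_on V a b -> a <= x <= b ->
    (Rbar_le (upperLD V a b x) (f x) <-> Rbar_le (- f x) (lowerLD (fun x => - V x) a b x))).
  { intros x HV Hx. rewrite upperLD_le, lowerLD_ge.
    split; intros [Hr Hl]; (split; intros Hb; [specialize (Hr Hb) | specialize (Hl Hb)]).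
    - apply (Hopp (LT_right V b x)); [| assumption]. intros s. apply LT_right_opp with a; [assumption | lra].
    - apply (Hopp (LT_left V a x)); [| assumption]. intros s. apply LT_left_opp with b; [assumption | lra].
    - apply (Hopp _ (LT_right (fun x => - V x) b x)); [| assumption].
      intros s. apply LT_right_opp with a; [assumption | lra].
    - apply (Hopp _ (LT_left (fun x => - V x) a x)); [| assumption].
      intros s. apply LT_left_opp with b; [assumption | lra]. }
  split; intros [HV Hm].
  - split; [apply cont_on_opp; assumption |]. intros x Hxab. destruct (Hm x Hxab) as [Hle _].
    apply Hx in Hle; try assumption. split; [assumption |]. intros Heq. rewrite Heq in Hle. exact Hle.
  (* The transfer of derivates presupposes continuity of [V] itself, recovered here by negating
     [- V]. *)
  - assert (HV' : cont_on V a b).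
    { intros x Hxab.
      assert (H : forall y, - - V y = V y) by (intros; ring). rewrite <- (H x).
      apply (filterlim_ext (F := within _ (locally x)) _ _ H).
      apply (cont_on_opp _ _ _ HV x Hxab). }
    split; [assumption |]. intros x Hxab. destruct (Hm x Hxab) as [Hle _].
    apply Hx in Hle; try assumption. split; [assumption |]. intros Heq. rewrite Heq in Hle. exact Hle.
Qed.

Lemma major_upper (f U : R -> R) (a b : R) : a < b -> major f U a b -> upper_le f a b (U b - U a).
Proof.
  intros Hab HU eps He. exists (fun x => U (clamp a b x)).
  split; [apply major_maj; assumption |]. rewrite !clamp_id by lra. lra.
Qed.

Lemma major_inf_upper (f : R -> R) (a b v : R) :
  a < b -> major_inf f a b = Finite v -> upper_le f a b v.
Proof.
  intros Hab Hv. apply upper_limit. intros eps He.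
  destruct (Rbar_glb_spec (fun y => exists U, major f U a b /\ y = Finite (U b - U a))) as [_ Hglb].
  fold (major_inf f a b) in Hglb. rewrite Hv in Hglb. apply NNPP. intros Hn.
  assert (H : Rbar_le (v + eps) v); [| simpl in H; lra].
  apply Hglb. intros y [U [HU ->]]. simpl. apply Rnot_lt_le. intros Hlt. apply Hn.
  apply (upper_mono _ f _ _ (U b - U a)); [intros; lra | lra |]. apply major_upper; assumption.
Qed.

Lemma minor_sup_upper (f : R -> R) (a b v : R) :
  a < b -> minor_sup f a b = Finite v -> upper_le (fun x => - f x) a b (- v).
Proof.
  intros Hab Hv. apply upper_limit. intros eps He.
  destruct (Rbar_lub_spec (fun y => exists V, minor f V a b /\ y = Finite (V b - V a))) as [_ Hlub].
  fold (minor_sup f a b) in Hlub. rewrite Hv in Hlub. apply NNPP. intros Hn.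
  assert (H : Rbar_le v (v - eps)); [| simpl in H; lra].
  apply Hlub. intros y [V [HV ->]]. simpl. apply Rnot_lt_le. intros Hlt. apply Hn.
  apply minor_opp_major in HV. apply major_upper in HV; [| assumption].
  apply (upper_mono _ (fun x => - f x) _ _ (- V b - - V a)); [intros; lra | lra | assumption].
Qed.

Lemma integ_major_inf (f : R -> R) (a b v : R) :
  a < b -> integ f a b v -> major_inf f a b = Finite v.
Proof.
  intros Hab [H1 H2]. apply Rbar_is_glb_unique. split.
  - intros y [U [HU ->]]. apply major_upper in HU; [| assumption]. simpl.
    assert (0 <= (U b - U a) + - v); [| lra]. apply (upper_opp f a b); try assumption. lra.
  - intros y Hy. apply Rbar_le_approx_r. intros eps He. destruct (H1 eps He) as [U [HU Hu]]. apply maj_major in HU.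
    apply Rbar_le_trans with (Finite (U b - U a)); [apply Hy; exists U; split; [assumption | reflexivity] |].
    exact Hu.
Qed.

Lemma integ_minor_sup (f : R -> R) (a b v : R) :
  a < b -> integ f a b v -> minor_sup f a b = Finite v.
Proof.
  intros Hab [H1 H2]. apply Rbar_is_lub_unique. split.
  - intros y [V [HV ->]]. apply minor_opp_major in HV. apply major_upper in HV; [| assumption]. simpl.
    assert (0 <= v + (- V b - - V a)); [| lra]. apply (upper_opp f a b); try assumption. lra.
  - intros y Hy. apply Rbar_le_approx_l. intros eps He. destruct (H2 eps He) as [U [HU Hu]].
    apply Rbar_le_trans with (Finite (- U b - - U a)); [simpl; lra |].
    apply Hy. exists (fun x => - U x). split; [| reflexivity].
    apply minor_opp_major, maj_major.
    apply (maj_incr_le (fun x => - f x) _ U); [| assumption | intros; lra | intros; lra].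
    apply (continuity_opp (fun x => - U x)), (continuity_opp U), HU.
Qed.

Lemma LaplaceIntegrable_integ (f : R -> R) (a b : R) :
  a < b -> (LaplaceIntegrable f a b <-> exists v, integ f a b v).
Proof.
  intros Hab. split; intros [v Hv]; exists v.
  - split; [apply major_inf_upper | apply minor_sup_upper]; tauto.
  - split; [apply integ_minor_sup | apply integ_major_inf]; assumption.
Qed.

Lemma LInt_primitive (f F : R -> R) (a b x : R) :
  is_primitive f F a b -> a <= x <= b -> LInt f a x = F x - F a.
Proof.
  intros HF Hx. unfold LInt. destruct (Rle_dec x a) as [Hxa | Hxa].
  - assert (x = a) as -> by lra. lra.
  - rewrite (integ_major_inf f a x (F x - F a)); [reflexivity | lra |]. apply HF; lra.
Qed.

(** * Equiabsolute continuity *)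

Definition nonoverlapping (a b : R) (m : nat) (x y : nat -> R) : Prop :=
  (forall i, (i <= m)%nat -> a <= x i <= y i /\ y i <= b) /\
  (forall i j, (i <= m)%nat -> (j <= m)%nat -> i <> j -> y i <= x j \/ y j <= x i).

(* Induction on the number of intervals: [P] is collapsed to a constant on the last interval,
   which leaves its increments over the other intervals unchanged. *)
Lemma nonoverlapping_sum_le (P : R -> R) (a b : R) (m : nat) (x y : nat -> R) :
  (forall s t, a <= s <= t -> t <= b -> P s <= P t) ->
  nonoverlapping a b m x y ->
  sum_f_R0 (fun i => P (y i) - P (x i)) m <= P b - P a.
Proof.
  revert P. induction m as [| m IH]; intros P HP [Hin Hno]; simpl.
  - destruct (Hin 0%nat (le_n 0)). specialize (HP a (x 0%nat)) as H1. specialize (HP (y 0%nat) b) as H2. lra.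
  - set (c := x (S m)) in *. set (d := y (S m)) in *.
    assert (Hcd : a <= c <= d /\ d <= b) by (apply Hin; lia).
    set (Q t := P t - P (clamp c d t)).
    assert (HQ : forall s t, a <= s <= t -> t <= b -> Q s <= Q t).
    { intros s t Hs Ht. unfold Q.
      destruct (Rlt_dec t c) as [Htc | Htc].
      { rewrite !clamp_le by lra. specialize (HP s t Hs Ht). lra. }
      destruct (Rlt_dec d s) as [Hsd | Hsd].
      { rewrite !clamp_ge by lra. specialize (HP s t Hs Ht). lra. }
      (* Here [[s, t]] meets [[c, d]], so clamping can move [s] only to the right and [t] only to
         the left. *)
      assert (H1 : s <= clamp c d s) by (clamp_cases; lra).
      assert (H2 : clamp c d t <= t) by (clamp_cases; lra).
      assert (H3 := clamp_mono c d s t ltac:(lra) ltac:(lra)).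
      assert (P s <= P (clamp c d s)) by (apply HP; lra).
      assert (P (clamp c d t) <= P t) by (apply HP; lra). lra. }
    assert (H : sum_f_R0 (fun i => Q (y i) - Q (x i)) m <= Q b - Q a).
    { apply IH; [assumption |]. split; intros; [apply Hin | apply Hno]; lia. }
    rewrite (sum_eq _ (fun i => P (y i) - P (x i))) in H.
    + unfold Q in H. rewrite (clamp_ge c d b), (clamp_le c d a) in H by lra. lra.
    + intros i Hi. unfold Q. destruct (Hin i) as [Hi1 Hi2]; [lia |].
      destruct (Hno i (S m)) as [Hd | Hd]; try lia; fold c d in Hd.
      * rewrite !clamp_le by lra. lra.
      * rewrite !clamp_ge by lra. lra.
Qed.

Lemma equiabs_cont_single (F : nat -> R -> R) (a b eps : R) :
  equiabs_cont F a b -> 0 < eps ->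
  exists eta, 0 < eta /\ forall n x y, a <= x <= y -> y <= b -> y - x < eta -> Rabs (F n y - F n x) < eps.
Proof.
  intros HF He. destruct (HF eps He) as [eta [Heta H]]. exists eta. split; [assumption |].
  intros n x y Hx Hy Hxy. apply (H 0%nat (fun _ => x) (fun _ => y)); try assumption.
  - intros; lra.
  - intros i j Hi Hj Hij. lia.
Qed.

(** From [a], any point of [[a, b]] is reached in a number of steps of length at most [eta / 2] that
    does not depend on [n], and each step changes [F n] by less than 1. *)
Lemma equiabs_cont_bounded (F : nat -> R -> R) (a b : R) :
  a <= b -> equiabs_cont F a b -> exists C, 0 < C /\ forall n, Rabs (F n b - F n a) <= C.
Proof.
  intros Hab HF. destruct (equiabs_cont_single F a b 1 HF) as [eta [Heta H]]; [lra |].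
  assert (Hk : forall n k x, a <= x <= b -> x - a <= INR k * (eta / 2) -> Rabs (F n x - F n a) <= INR k).
  { intros n k. induction k as [| k IH]; intros x Hx Hxk.
    - simpl in Hxk. assert (x = a) as -> by lra. rewrite Rminus_diag, Rabs_R0. simpl. lra.
    - rewrite S_INR in *. set (x' := Rmax a (x - eta / 2)).
      assert (Hx' : a <= x' <= x /\ x - eta / 2 <= x' /\ (x' = a \/ x' = x - eta / 2)).
      { unfold x', Rmax. destruct (Rle_dec a (x - eta / 2)); lra. }
      assert (Hk : 0 <= INR k) by apply pos_INR.
      assert (H1 : Rabs (F n x' - F n a) <= INR k).
      { apply IH; [lra |]. destruct Hx' as [_ [_ [-> | ->]]]; nra. }
      assert (H2 : Rabs (F n x - F n x') < 1) by (apply H; lra).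
      replace (F n x - F n a) with ((F n x' - F n a) + (F n x - F n x')) by ring.
      eapply Rle_trans; [apply Rabs_triang | lra]. }
  destruct (INR_archimed (eta / 2) (b - a)) as [N HN]; [lra |].
  exists (INR N + 1). split; [pose proof (pos_INR N); lra |]. intros n.
  apply Rle_trans with (INR N); [apply Hk; lra | lra].
Qed.

(* The family consists of the partition intervals on which [H] grows faster than [K x]; the
   degenerate interval [[a, a]] stands for an empty family. *)
Lemma psum_excess (H : R -> R) (K a y v : R) :
  0 <= K -> psum (incmax H (fun x => K * x)) a y v ->
  exists m xs ys, nonoverlapping a y m xs ys /\
    v - K * (y - a) <= sum_f_R0 (fun i => H (ys i) - H (xs i)) m /\
    K * sum_f_R0 (fun i => ys i - xs i) m <= sum_f_R0 (fun i => H (ys i) - H (xs i)) m.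
Proof.
  unfold incmax. intros HK. induction 1 as [y Hy | y z v Hv IH Hz].
  - assert (0 <= K * (y - a)) by (apply Rmult_le_pos; lra).
    destruct (Rle_dec (H y - H a) (K * y - K * a)) as [Hle | Hle].
    + rewrite Rmax_right by assumption. exists 0%nat, (fun _ => a), (fun _ => a). simpl.
      repeat split; intros; lra || lia.
    + rewrite Rmax_left by lra. exists 0%nat, (fun _ => a), (fun _ => y). simpl.
      repeat split; intros; lra || lia.
  - assert (Hay := psum_le _ _ _ _ Hv). assert (0 <= K * (z - y)) by (apply Rmult_le_pos; lra).
    destruct IH as [m [xs [ys [[Hin Hno] [H1 H2]]]]].
    destruct (Rle_dec (H z - H y) (K * z - K * y)) as [Hle | Hle].
    + rewrite Rmax_right by assumption. exists m, xs, ys. repeat split; try lra; try assumption;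
        intros; specialize (Hin i); lra || (destruct Hin; [assumption | lra]).
    + rewrite Rmax_left by lra.
      exists (S m), (fun i => if Nat.eq_dec i (S m) then y else xs i),
                    (fun i => if Nat.eq_dec i (S m) then z else ys i).
      assert (Hsum : forall h : R -> R -> R,
        sum_f_R0 (fun i => h (if Nat.eq_dec i (S m) then y else xs i)
                             (if Nat.eq_dec i (S m) then z else ys i)) (S m)
        = sum_f_R0 (fun i => h (xs i) (ys i)) m + h y z).
      { intros h. rewrite tech5. destruct (Nat.eq_dec (S m) (S m)) as [_ | Hn]; [| lia]. f_equal.
        apply sum_eq. intros i Hi. destruct (Nat.eq_dec i (S m)); [lia | reflexivity]. }
      rewrite (Hsum (fun s t => H t - H s)), (Hsum (fun s t => t - s)).
      split; [split |].
      * intros i Hi. destruct (Nat.eq_dec i (S m)); [lra |]. destruct (Hin i); [lia |]. lra.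
      * intros i j Hi Hj Hij.
        destruct (Nat.eq_dec i (S m)), (Nat.eq_dec j (S m)); try lia.
        -- right. apply Hin. lia.
        -- left. apply Hin. lia.
        -- apply Hno; lia.
      * lra.
Qed.

Lemma uniform_integrability (Hs : nat -> R -> R) (a b eps : R) :
  a <= b -> equiabs_cont Hs a b ->
  (forall n x y, a <= x <= y -> y <= b -> Hs n x <= Hs n y) -> 0 < eps ->
  exists K, 0 < K /\ forall n c v, a <= c <= b ->
    psum (incmax (Hs n) (fun x => K * x)) a c v -> v <= K * (c - a) + eps.
Proof.
  intros Hab Heq Hinc He. destruct (equiabs_cont_bounded Hs a b Hab Heq) as [C [HC HCb]].
  destruct (Heq eps He) as [eta [Heta Hsum]].
  (* The selected intervals then have total length at most [C / K = eta / 2]; the factor 2 makes the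
     inequality with [eta] strict. *)
  exists (2 * C / eta). assert (HK : 0 < 2 * C / eta) by (apply Rdiv_lt_0_compat; lra).
  split; [assumption |]. intros n c v Hc Hv.
  destruct (psum_excess _ _ _ _ _ (Rlt_le _ _ HK) Hv) as [m [xs [ys [[Hin Hno] [H1 H2]]]]].
  set (S1 := sum_f_R0 (fun i => Hs n (ys i) - Hs n (xs i)) m) in *.
  assert (Hin' : forall i, (i <= m)%nat -> a <= xs i <= ys i /\ ys i <= b)
    by (intros i Hi; destruct (Hin i Hi); lra).
  assert (HS1 : S1 <= C).
  { apply Rle_trans with (Hs n b - Hs n a).
    - apply nonoverlapping_sum_le; [apply Hinc | split; assumption].
    - eapply Rle_trans; [apply Rle_abs | apply HCb]. }
  assert (Hlen : sum_f_R0 (fun i => ys i - xs i) m < eta).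
  { apply Rmult_lt_reg_l with (2 * C / eta); [assumption |].
    replace (2 * C / eta * eta) with (2 * C) by (field; lra). lra. }
  specialize (Hsum m xs ys Hin' Hno Hlen n).
  assert (S1 <= sum_f_R0 (fun i => Rabs (Hs n (ys i) - Hs n (xs i))) m)
    by (apply sum_Rle; intros; apply Rle_abs).
  lra.
Qed.

(** * Vitali's theorem for nonnegative sequences *)

Lemma primitive_const (K a b : R) : 0 < K -> is_primitive (fun _ => K) (fun x => K * x) a b.
Proof.
  intros HK x y _ _. replace (K * y - K * x) with (K * (y - x)) by ring. apply integ_const; assumption.
Qed.

Lemma primitive_restrict (f F : R -> R) (a b c d : R) :
  a <= c -> d <= b -> is_primitive f F a b -> is_primitive f F c d.
Proof. intros Hc Hd HF x y Hx Hy. apply HF; lra. Qed.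

(** Fatou's lemma on [[a, b]] makes [h] integrable, and on [[a, x]] it gives the lower bound for the
    limit. For the upper bound, the integral of [hs n] exceeds that of its truncation by at most
    [eps / 3], uniformly in [n], and the truncations converge to an integral below that of [h]. *)
Lemma vitali_sufficient (hs Hs : nat -> R -> R) (h : R -> R) (a b : R) :
  a <= b ->
  (forall n x, a <= x <= b -> 0 <= hs n x) ->
  (forall n, is_primitive (hs n) (Hs n) a b) ->
  (forall x, a <= x <= b -> is_lim_seq (fun n => hs n x) (h x)) ->
  equiabs_cont Hs a b ->
  exists H, is_primitive h H a b /\
    forall x, a <= x <= b -> is_lim_seq (fun n => Hs n x - Hs n a) (H x - H a).
Proof.
  intros Hab Hpos HHs Hlim Heq.
  assert (Hinc : forall n x y, a <= x <= y -> y <= b -> Hs n x <= Hs n y)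
    by (intros n x y; apply (primitive_incr (hs n) (Hs n) a b); auto).
  destruct (equiabs_cont_bounded Hs a b Hab Heq) as [C [_ HC]].
  assert (HCx : forall n x, a <= x <= b -> Hs n x - Hs n a <= C).
  { intros n x Hx. specialize (HC n). apply Rabs_le_between in HC. specialize (Hinc n x b). lra. }
  destruct (fatou hs (fun n => Hs n b - Hs n a) h a b C) as [l [Hl _]]; try assumption.
  { intros n. apply HHs; lra. }
  { intros n. apply HCx; lra. }
  destruct (primitive_exists h a b l Hab Hl) as [H [HH _]].
  exists H. split; [assumption |]. intros x Hx.
  destruct (fatou hs (fun n => Hs n x - Hs n a) h a x C) as [l' [Hl' Hlow]]; try lra.
  { intros n. apply HHs; lra. }
  { intros n z Hz. apply Hpos; lra. }
  { intros n. apply HCx; lra. }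
  { intros z Hz. apply Hlim; lra. }
  assert (HHx : integ h a x (H x - H a)) by (apply HH; lra).
  assert (l' = H x - H a) as -> by (apply (integ_unique h a x); [lra | assumption | assumption]).
  apply is_lim_seq_eps. intros eps He.
  destruct (uniform_integrability Hs a b (eps / 3) Hab Heq Hinc) as [K [HK HUI]]; [lra |].
  (* The minimum is [hs n + K] minus the maximum, and [uniform_integrability] bounds every partition
     sum for the maximum by [K * (x - a) + eps / 3]. *)
  assert (Htr : forall n, exists w, integ (fun z => Rmin (hs n z) K) a x w /\
             Hs n x - Hs n a - eps / 3 <= w).
  { intros n.
    destruct (integ_max_lub (hs n) (fun _ => K) (Hs n) (fun z => K * z) a x) as [m [[_ Hm] Hmi]]; try lra.
    - intros z Hz. apply Hpos; lra.
    - intros; lra.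
    - apply primitive_restrict with a b; [lra | lra | apply HHs].
    - apply primitive_const; assumption.
    - exists (Hs n x - Hs n a + K * (x - a) - m). split.
      + apply (integ_ext (fun z => hs n z + K - Rmax (hs n z) K)).
        * intros z _. symmetry. apply Rmin_plus_minus_Rmax.
        * apply (integ_minus (fun z => hs n z + K)); [| assumption].
          apply integ_plus; [apply HHs; lra | apply integ_const; assumption].
      + assert (m <= K * (x - a) + eps / 3); [| lra].
        apply Hm. intros v Hv. apply (HUI n); [lra | assumption]. }
  pose (w n := proj1_sig (constructive_indefinite_description _ (Htr n))).
  assert (Hw : forall n, integ (fun z => Rmin (hs n z) K) a x (w n) /\ Hs n x - Hs n a - eps / 3 <= w n)
    by (intros n; exact (proj2_sig (constructive_indefinite_description _ (Htr n)))).
  clearbody w.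
  destruct (dominated_convergence (fun n z => Rmin (hs n z) K) w (fun z => Rmin (h z) K) (fun _ => K)
              a x (K * (x - a))) as [r [Hr Hwr]]; try lra.
  { intros n. apply Hw. }
  { apply integ_const; assumption. }
  { intros n z Hz. split; [apply Rmin_glb; [apply Hpos |]; lra | apply Rmin_r]. }
  { intros z Hz. apply is_lim_seq_eps. intros e He'. specialize (Hlim z ltac:(lra)).
    rewrite is_lim_seq_eps in Hlim. destruct (Hlim e He') as [N HN]. exists N. intros n Hn.
    specialize (HN n Hn). apply Rabs_lt_between in HN. apply Rabs_lt_between.
    unfold Rmin. destruct (Rle_dec (hs n z) K), (Rle_dec (h z) K); lra. }
  assert (Hrle : r <= H x - H a).
  { apply (integ_le (fun z => Rmin (h z) K) h a x); try assumption; [lra |]. intros; apply Rmin_l. }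
  rewrite is_lim_seq_eps in Hwr. destruct (Hwr (eps / 3)) as [N HN]; [lra |].
  destruct (Hlow (eps / 2)) as [N' HN']; [lra |].
  exists (max N N'). intros n Hn. specialize (HN n ltac:(lia)). specialize (HN' n ltac:(lia)).
  destruct (Hw n) as [_ Hwn]. apply Rabs_lt_between in HN. apply Rabs_lt_between. lra.
Qed.

Lemma integ_sum (hs : nat -> R -> R) (v : nat -> R) (a b : R) (N : nat) :
  (forall n, integ (hs n) a b (v n)) ->
  integ (fun x => sum_f_R0 (fun k => hs k x) N) a b (sum_f_R0 v N).
Proof.
  intros H. induction N as [| N IH]; simpl; [apply H |]. apply integ_plus; [assumption | apply H].
Qed.

(* Scheffe: [|hs n - h| = hs n + h - 2 min (hs n, h)] and the minima are dominated by [h]. *)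
Lemma scheffe (hs : nat -> R -> R) (h : R -> R) (v : nat -> R) (a b l : R) :
  a <= b ->
  (forall n x, a <= x <= b -> 0 <= hs n x) -> (forall x, a <= x <= b -> 0 <= h x) ->
  (forall n, integ (hs n) a b (v n)) -> integ h a b l ->
  (forall x, a <= x <= b -> is_lim_seq (fun n => hs n x) (h x)) ->
  is_lim_seq v l ->
  exists d : nat -> R, (forall n, integ (fun x => Rabs (hs n x - h x)) a b (d n)) /\ is_lim_seq d 0.
Proof.
  intros Hab Hpos Hh Hv Hl Hlim Hvl.
  assert (Hmin : forall n, exists w, integ (fun x => Rmin (hs n x) (h x)) a b w)
    by (intros n; apply (integ_min (hs n) h a b (v n) l); auto).
  pose (w n := proj1_sig (constructive_indefinite_description _ (Hmin n))).
  assert (Hw : forall n, integ (fun x => Rmin (hs n x) (h x)) a b (w n))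
    by (intros n; exact (proj2_sig (constructive_indefinite_description _ (Hmin n)))).
  clearbody w.
  destruct (dominated_convergence (fun n x => Rmin (hs n x) (h x)) w h h a b l) as [r [Hr Hwr]];
    try assumption.
  { intros n x Hx. split; [apply Rmin_glb; auto | apply Rmin_r]. }
  { intros x Hx. apply is_lim_seq_eps. intros e He. specialize (Hlim x Hx).
    rewrite is_lim_seq_eps in Hlim. destruct (Hlim e He) as [N HN]. exists N. intros n Hn.
    specialize (HN n Hn). apply Rabs_lt_between in HN. apply Rabs_lt_between.
    unfold Rmin. destruct (Rle_dec (hs n x) (h x)); lra. }
  assert (r = l) as -> by (apply (integ_unique h a b); assumption).
  (* Both [v] and [w] tend to [l], so this tends to 0. *)
  exists (fun n => (v n + l) - (w n + w n)). split.
  - intros n. apply (integ_ext (fun x => (hs n x + h x) - (Rmin (hs n x) (h x) + Rmin (hs n x) (h x)))).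
    + intros x _. unfold Rmin, Rabs. destruct (Rle_dec (hs n x) (h x)), (Rcase_abs _); lra.
    + apply (integ_minus (fun x => hs n x + h x) (fun x => Rmin (hs n x) (h x) + Rmin (hs n x) (h x)));
        apply integ_plus; auto.
  - replace 0 with ((l + l) - (l + l)) by ring.
    apply is_lim_seq_minus'; apply is_lim_seq_plus'; try assumption. apply is_lim_seq_const.
Qed.

(** Every [hs n] is at most [D + q], with a single integrable [q] and a nonnegative [D] of integral
    below [eps / 3]. Splitting [q] into its excess over [K] and its truncation leaves one more small
    integral and a part of slope at most [K]. *)
Lemma vitali_necessary (hs Hs : nat -> R -> R) (h : R -> R) (a b l : R) :
  a <= b ->
  (forall n x, a <= x <= b -> 0 <= hs n x) -> (forall x, a <= x <= b -> 0 <= h x) ->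
  (forall n, is_primitive (hs n) (Hs n) a b) -> integ h a b l ->
  (forall x, a <= x <= b -> is_lim_seq (fun n => hs n x) (h x)) ->
  is_lim_seq (fun n => Hs n b - Hs n a) l ->
  equiabs_cont Hs a b.
Proof.
  intros Hab Hpos Hh HHs Hl Hlim Hvl eps He.
  assert (Hv : forall n, integ (hs n) a b (Hs n b - Hs n a)) by (intros n; apply HHs; lra).
  destruct (scheffe hs h _ a b l Hab Hpos Hh Hv Hl Hlim Hvl) as [d [Hd Hd0]].
  rewrite is_lim_seq_eps in Hd0. destruct (Hd0 (eps / 3)) as [N HN]; [lra |].
  (* The sum takes care of the finitely many indices up to [N], for which mean convergence says
     nothing. *)
  pose (q x := h x + sum_f_R0 (fun k => hs k x) N).
  assert (Hsumpos : forall x, a <= x <= b -> 0 <= sum_f_R0 (fun k => hs k x) N)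
    by (intros x Hx; apply cond_pos_sum; intros; apply Hpos; assumption).
  assert (Hqpos : forall x, a <= x <= b -> 0 <= q x).
  { intros x Hx. specialize (Hh x Hx). specialize (Hsumpos x Hx). unfold q. lra. }
  assert (Hqi := integ_plus _ _ _ _ _ _ Hl (integ_sum hs _ a b N Hv)). fold q in Hqi.
  destruct (truncation_approx q a b _ (eps / 3) Hab Hqpos Hqi) as [K [w [HK [Hw Hwq]]]]; [lra |].
  destruct (primitive_exists (fun x => q x - Rmin (q x) K) a b _ Hab (integ_minus _ _ _ _ _ _ Hqi Hw))
    as [B [HB HBv]].
  (* [D] is 0 for [n <= N] and [Rabs (hs n x - h x)] for larger [n]. *)
  assert (Hbound : forall n, exists A c D, is_primitive D A a b /\ A b - A a = c /\ c < eps / 3 /\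
             (forall x, a <= x <= b -> 0 <= D x) /\ (forall x, a <= x <= b -> hs n x <= D x + q x)).
  { intros n. destruct (Nat.le_gt_cases n N) as [Hn | Hn].
    - destruct (primitive_exists (fun _ => 0) a b 0 Hab (integ_zero a b)) as [A [HA HAv]].
      exists A, 0, (fun _ => 0). split; [| split; [| split; [| split]]]; try assumption; try (intros; lra).
      intros x Hx. assert (hs n x <= sum_f_R0 (fun k => hs k x) N).
      { clear - Hn Hpos Hx. induction N as [| N IH]; [replace n with 0%nat by lia; simpl; lra |].
        simpl. destruct (Nat.eq_dec n (S N)) as [-> | Hne].
        - assert (0 <= sum_f_R0 (fun k => hs k x) N) by (apply cond_pos_sum; intros; apply Hpos; assumption). lra.
        - specialize (Hpos (S N) x Hx). specialize (IH ltac:(lia)). lra. }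
      specialize (Hh x Hx). unfold q. lra.
    - destruct (primitive_exists _ a b (d n) Hab (Hd n)) as [A [HA HAv]].
      exists A, (d n), (fun x => Rabs (hs n x - h x)). split; [| split; [| split; [| split]]]; try assumption.
      + specialize (HN n ltac:(lia)). apply Rabs_lt_between in HN. lra.
      + intros x _. apply Rabs_pos.
      + intros x Hx. specialize (Hsumpos x Hx). pose proof (Rle_abs (hs n x - h x)). unfold q. lra. }
  (* The truncated part then contributes less than [K * eta = eps / 3]; the increments of [A] and of
     [B] contribute less than [eps / 3] each. *)
  exists (eps / (3 * K)). split; [apply Rdiv_lt_0_compat; lra |].
  intros m x y Hin Hno Hlen n. destruct (Hbound n) as [A [c [D [HA [HAc [Hc [HD Hle]]]]]]].
  assert (Hinc : forall s t, a <= s <= t -> t <= b ->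
            0 <= Hs n t - Hs n s <= (A t + B t) - (A s + B s) + K * (t - s)).
  { intros s t Hs' Ht. split.
    - apply (integ_nonneg (hs n) s t); [lra | intros; apply Hpos; lra | apply HHs; assumption].
    - replace ((A t + B t) - (A s + B s)) with ((A t - A s) + (B t - B s)) by ring.
      apply (integ_le (hs n) (fun x => (D x + (q x - Rmin (q x) K)) + K) s t); [lra | | |].
      + intros z Hz. specialize (Hle z ltac:(lra)). pose proof (Rmin_r (q z) K). lra.
      + apply HHs; assumption.
      + apply integ_plus; [| apply integ_const; assumption].
        apply integ_plus; [apply HA | apply HB]; assumption. }
  assert (HABi : forall s t, a <= s <= t -> t <= b -> A s + B s <= A t + B t).
  { intros s t Hs' Ht. apply Rplus_le_compat.
    - apply (primitive_incr D A a b); assumption.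
    - apply (primitive_incr _ B a b s t HB); try assumption.
      intros z _. pose proof (Rmin_l (q z) K). lra. }
  assert (HAB := nonoverlapping_sum_le (fun t => A t + B t) a b m x y HABi (conj Hin Hno)).
  apply Rle_lt_trans with (sum_f_R0 (fun i => (A (y i) + B (y i)) - (A (x i) + B (x i)) + (y i - x i) * K) m).
  - apply sum_Rle. intros i Hi. destruct (Hin i Hi) as [H1 H2]. specialize (Hinc _ _ H1 H2).
    rewrite Rabs_pos_eq by lra. lra.
  - rewrite sum_plus, <- scal_sum.
    apply Rmult_lt_compat_l with (r := K) in Hlen; [| assumption].
    replace (K * (eps / (3 * K))) with (eps / 3) in Hlen by (field; lra). lra.
Qed.

(** * Reduction to nonnegative sequences *)

Lemma equiabs_cont_shift (F G : nat -> R -> R) (c : nat -> R) (a b : R) :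
  (forall n x, a <= x <= b -> G n x = F n x + c n) -> equiabs_cont F a b -> equiabs_cont G a b.
Proof.
  intros HFG HF eps He. destruct (HF eps He) as [eta [Heta H]]. exists eta. split; [assumption |].
  intros m x y Hin Hno Hlen n. specialize (H m x y Hin Hno Hlen n).
  rewrite (sum_eq _ (fun i => Rabs (F n (y i) - F n (x i)))); [assumption |].
  intros i Hi. destruct (Hin i Hi). rewrite !HFG by lra. f_equal. ring.
Qed.

Theorem theorem7p1 (a b : R) (fs : nat -> R -> R) (g f : R -> R) :
  a < b ->
  (forall n, LaplaceIntegrable (fs n) a b) ->
  LaplaceIntegrable g a b ->
  (forall n, ae_on a b (fun x => g x <= fs n x)) ->
  ae_on a b (fun x => is_lim_seq (fun n => fs n x) (f x)) ->
  ((LaplaceIntegrable f a b /\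
    forall x, a <= x <= b ->
      is_lim_seq (fun n => LInt (fs n) a x) (LInt f a x))
   <->
   equiabs_cont (fun n x => LInt (fun t => fs n t - g t) a x) a b).
Proof.
  intros Hab Hfs Hg Hge Hlim.
  assert (Hab' : a <= b) by lra.
  assert (HFs : forall n, exists F, is_primitive (fs n) F a b).
  { intros n. destruct (proj1 (LaplaceIntegrable_integ _ _ _ Hab) (Hfs n)) as [v Hv].
    destruct (primitive_exists (fs n) a b v Hab' Hv) as [F [HF _]]. exists F. assumption. }
  pose (F n := proj1_sig (constructive_indefinite_description _ (HFs n))).
  assert (HF : forall n, is_primitive (fs n) (F n) a b)
    by (intros n; exact (proj2_sig (constructive_indefinite_description _ (HFs n)))).
  clearbody F.
  destruct (proj1 (LaplaceIntegrable_integ _ _ _ Hab) Hg) as [vg Hvg].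
  destruct (primitive_exists g a b vg Hab' Hvg) as [G [HG HGv]].
  (* Index 0 is the set of failing convergence and index [S n] that of failing [g <= fs n], so that
     one countable union collects every exception. *)
  pose (E k x := match k with
                 | O => a <= x <= b /\ ~ is_lim_seq (fun n => fs n x) (f x)
                 | S n => a <= x <= b /\ ~ g x <= fs n x
                 end).
  pose (Z x := exists k, E k x).
  (* All intervals are covered because [integ_ae] is later applied on each subinterval [[x, y]]. *)
  assert (HZ : forall c d, c <= d -> negligible Z c d).
  { intros c d Hcd. apply negligible_union; [assumption |].
    intros [| n]; apply null_set_negligible; try assumption; apply Hge. }
  assert (HZlim : forall x, a <= x <= b -> ~ Z x -> is_lim_seq (fun n => fs n x) (f x)).
  { intros x Hx HnZ. apply NNPP. intros Hn. apply HnZ. exists 0%nat. split; assumption. }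
  assert (HZge : forall n x, a <= x <= b -> ~ Z x -> g x <= fs n x).
  { intros n x Hx HnZ. apply NNPP. intros Hn. apply HnZ. exists (S n). split; assumption. }
  (* The value 0 on [Z] makes nonnegativity and convergence hold at every point of [[a, b]] without
     changing any integral. *)
  pose (cut := fun (u : R -> R) x => if excluded_middle_informative (Z x) then 0 else u x - g x).
  assert (Hcut : forall u x, ~ Z x -> cut u x = u x - g x).
  { intros u x HnZ. unfold cut. destruct (excluded_middle_informative (Z x)); tauto. }
  pose (hs n := cut (fs n)). pose (h := cut f).
  assert (Hpos : forall n x, a <= x <= b -> 0 <= hs n x).
  { intros n x Hx. unfold hs, cut. destruct (excluded_middle_informative (Z x)) as [HZx | HZx]; [lra |].
    specialize (HZge n x Hx HZx). lra. }
  assert (Hhlim : forall x, a <= x <= b -> is_lim_seq (fun n => hs n x) (h x)).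
  { intros x Hx. unfold hs, h, cut.
    destruct (excluded_middle_informative (Z x)) as [HZx | HZx]; [apply is_lim_seq_const |].
    apply is_lim_seq_minus'; [apply HZlim; assumption | apply is_lim_seq_const]. }
  assert (Hh : forall x, a <= x <= b -> 0 <= h x).
  { intros x Hx. apply (Un_cv_ge_eventually (fun n => hs n x) _ _ 0%nat).
    - apply is_lim_seq_Reals, Hhlim, Hx.
    - intros n _. apply Hpos, Hx. }
  pose (Hs n x := F n x - G x).
  assert (Hdiff : forall n, is_primitive (fun t => fs n t - g t) (Hs n) a b).
  { intros n x y Hx Hy. unfold Hs.
    replace (F n y - G y - (F n x - G x)) with ((F n y - F n x) - (G y - G x)) by ring.
    apply integ_minus; [apply HF | apply HG]; assumption. }
  assert (HHs : forall n, is_primitive (hs n) (Hs n) a b).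
  { intros n x y Hx Hy. apply (integ_ae Z (fun t => fs n t - g t)); [lra | apply HZ; lra | |].
    - intros t _ HnZ. symmetry. apply Hcut, HnZ.
    - apply Hdiff; assumption. }
  split.
  - intros [Hf Hconv].
    destruct (proj1 (LaplaceIntegrable_integ _ _ _ Hab) Hf) as [vf Hvf].
    destruct (primitive_exists f a b vf Hab' Hvf) as [Ff [HFf HFfv]].
    apply (equiabs_cont_shift Hs _ (fun n => - Hs n a)).
    { intros n x Hx. rewrite (LInt_primitive _ (Hs n) a b) by (try apply Hdiff; assumption). ring. }
    apply (vitali_necessary hs Hs h a b (vf - vg)); try assumption.
    + apply (integ_ae Z (fun t => f t - g t)); [assumption | apply HZ; lra | |].
      * intros t _ HnZ. symmetry. apply Hcut, HnZ.
      * apply integ_minus; assumption.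
    (* Convergence of the total integrals, the case [x = b], is what Scheffe's argument turns into
       convergence in mean. *)
    + specialize (Hconv b ltac:(lra)). rewrite (LInt_primitive f Ff a b), HFfv in Hconv by (try assumption; lra).
      apply (is_lim_seq_ext (fun n => LInt (fs n) a b - (G b - G a))).
      * intros n. rewrite (LInt_primitive (fs n) (F n) a b) by (try apply HF; lra). unfold Hs. ring.
      * rewrite HGv. apply is_lim_seq_minus'; [assumption | apply is_lim_seq_const].
  - intros Heq.
    apply (equiabs_cont_shift _ Hs (fun n => Hs n a)) in Heq.
    2: { intros n x Hx. rewrite (LInt_primitive _ (Hs n) a b) by (try apply Hdiff; assumption). ring. }
    destruct (vitali_sufficient hs Hs h a b) as [H [HH HHlim]]; try assumption.
    (* Off [Z] the function [f] is [h + g], so the primitives add. *)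
    assert (HFf : is_primitive f (fun x => H x + G x) a b).
    { intros x y Hx Hy. apply (integ_ae Z (fun t => h t + g t)); [lra | apply HZ; lra | |].
      - intros t _ HnZ. unfold h. rewrite Hcut by assumption. ring.
      - replace (H y + G y - (H x + G x)) with ((H y - H x) + (G y - G x)) by ring.
        apply integ_plus; [apply HH | apply HG]; assumption. }
    split.
    + apply LaplaceIntegrable_integ; [assumption |]. eexists. apply HFf; lra.
    + intros x Hx. rewrite (LInt_primitive f (fun x => H x + G x) a b) by assumption.
      apply (is_lim_seq_ext (fun n => (Hs n x - Hs n a) + (G x - G a))).
      * intros n. rewrite (LInt_primitive (fs n) (F n) a b) by (try apply HF; assumption). unfold Hs. ring.
      * replace (H x + G x - (H a + G a)) with ((H x - H a) + (G x - G a)) by ring.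
        apply is_lim_seq_plus'; [apply HHlim; assumption | apply is_lim_seq_const].
Qed.
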